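(* Let $d\in\{2,3\}$. Consider a $d$-polytope in $\mathbb R^d$, whose boundary does not intersect itself, with $J$ edges ($d=2$) or faces ($d=3$). For $j=1,\dots,J$ let $\mathcal L_j>0$ be the $(d-1)$-dimensional Lebesgue measure and $\boldsymbol\xi_j=(\xi_j^{(1)},\dots,\xi_j^{(d)})$ the unit outward normal vector of the $j$-th edge or face. Let $\omega_1,\dots,\omega_Q$ be positive numbers with $\sum_{i=1}^Q\omega_i=1$. Assume that $$\mathbf U^{ij}=(D^{ij},\mathbf m^{ij},\mathbf B^{ij},E^{ij})^\top\in\mathcal G,\qquad i=1,\dots,Q,\ j=1,\dots,J,$$ satisfy the discrete divergence-free condition $$\sum_{j=1}^J\Big[\sum_{i=1}^Q\omega_i\,\langle\boldsymbol\xi_j,\mathbf B^{ij}\rangle\Big]\mathcal L_j=0 .$$ Then for all $\alpha\ge 1$, $$\bar{\mathbf U}:=\frac{1}{\sum_{j=1}^J\mathcal L_j}\sum_{j=1}^J\Big[\sum_{i=1}^Q\omega_i\Big(\mathbf U^{ij}-\alpha^{-1}\big\langle\boldsymbol\xi_j,\mathbf F(\mathbf U^{ij})\big\rangle\Big)\Big]\mathcal L_j\ \in\ \overline{\mathcal G}.$$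
   Context: Units are such that the speed of light is $c=1$; $\mathbb R^+=(0,\infty)$. Equation of state (EOS): the specific enthalpy is a function $h=h(p,\rho)$, differentiable on $\mathbb R^+\times\mathbb R^+$, satisfying for all $p,\rho>0$ (i) $h(p,\rho)\ge\sqrt{1+p^2/\rho^2}+p/\rho$; (ii) $h\big(\tfrac1\rho-\tfrac{\partial h}{\partial p}\big)<\tfrac{\partial h}{\partial\rho}<0$; (iii) $\lim_{p\to0^+}h(p,\rho)=1$ for each fixed $\rho>0$. Conservative variables: given $\rho>0$, $p>0$, $\mathbf v\in\mathbb R^3$ with $|\mathbf v|<1$, $\mathbf B\in\mathbb R^3$, put $W=(1-|\mathbf v|^2)^{-1/2}$, $h=h(p,\rho)$, $p_m=\frac12\big(W^{-2}|\mathbf B|^2+(\mathbf v\cdot\mathbf B)^2\big)$, $p_{tot}=p+p_m$, and $$D=\rho W,\quad \mathbf m=\rho hW^2\mathbf v+|\mathbf B|^2\mathbf v-(\mathbf v\cdot\mathbf B)\mathbf B,\quad E=\rho hW^2-p_{tot}+|\mathbf B|^2,\quad \mathbf U=(D,\mathbf m,\mathbf B,E)^\top\in\mathbb R^8.$$ The admissible state set $\mathcal G\subset\mathbb R^8$ is the set of all $\mathbf U$ obtained in this way (i.e. $\rho(\mathbf U)>0$, $p(\mathbf U)>0$, $|\mathbf v(\mathbf U)|<1$). Fluxes: for $\mathbf U\in\mathcal G$ and $\ell=1,\dots,d$, with $\mathbf e_\ell$ the $\ell$-th row of the $3\times3$ identity matrix, $$\mathbf F_\ell(\mathbf U)=\Big(Dv_\ell,\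 v_\ell\mathbf m-B_\ell\big(W^{-2}\mathbf B+(\mathbf v\cdot\mathbf B)\mathbf v\big)+p_{tot}\mathbf e_\ell,\ v_\ell\mathbf B-B_\ell\mathbf v,\ m_\ell\Big)^\top.$$ For $\boldsymbol\xi\in\mathbb R^d$: $\langle\boldsymbol\xi,\mathbf B\rangle=\sum_{\ell=1}^d\xi_\ell B_\ell$ and $\langle\boldsymbol\xi,\mathbf F(\mathbf U)\rangle=\sum_{\ell=1}^d\xi_\ell\mathbf F_\ell(\mathbf U)$. For $\mathbf v^*,\mathbf B^*\in\mathbb R^3$ with $|\mathbf v^*|<1$ let $$\mathbf n^*=\Big(-\sqrt{1-|\mathbf v^*|^2},\ -\mathbf v^*,\ -(1-|\mathbf v^*|^2)\mathbf B^*-(\mathbf v^*\cdot\mathbf B^* )\mathbf v^*,\ 1\Big)^\top,\qquad p_m^*=\tfrac12\big((1-|\mathbf v^*|^2)|\mathbf B^*|^2+(\mathbf v^*\cdot\mathbf B^* )^2\big).$$ Define $$\overline{\mathcal G}=\big\{\mathbf U=(D,\mathbf m,\mathbf B,E)^\top\in\mathbb R^8:\ D>0,\ \mathbf U\cdot\mathbf n^*+p_m^*\ge0\ \text{for all }\mathbf B^*,\mathbf v^*\in\mathbb R^3\text{ with }|\mathbf v^*|<1\big\}.$$ *)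

(* Defs.v *)
From HB Require Import structures.
From mathcomp Require Import all_boot all_order all_algebra.
From mathcomp Require Import all_classical all_reals all_analysis.

Set Implicit Arguments.
Unset Strict Implicit.
Unset Printing Implicit Defensive.

Import Order.TTheory GRing.Theory Num.Theory numFieldNormedType.Exports.

Local Open Scope classical_set_scope.
Local Open Scope ring_scope.

(* The library norm on ['rV[R]_n] is the sup norm, so the Euclidean inner
   product and norm are introduced here.  The library topology on ['rV[R]_n]
   is the usual one. *)
Definition dot (R : realType) (n : nat) (u v : 'rV[R]_n) : R :=
  \sum_(i < n) u 0 i * v 0 i.

Definition enorm (R : realType) (n : nat) (u : 'rV[R]_n) : R :=
  Num.sqrt (dot u u).

(** * Polytopes *)

(* Finite union of finite intersections of closed half-spaces.  A common number
   [n] of constraints is no restriction: [0 <= 0] can be used as padding. *)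
Definition polyhedral (R : realType) (d : nat) (A : set 'rV[R]_d) : Prop :=
  exists (m n : nat) (a : 'I_m -> 'I_n -> 'rV[R]_d) (b : 'I_m -> 'I_n -> R),
    A = [set x | exists i : 'I_m, forall k : 'I_n, dot (a i k) x <= b i k].

(* Not assumed convex. *)
Record polytope (R : realType) (d : nat) (P : set 'rV[R]_d) : Prop := {
  polytope_polyhedral : polyhedral P ;
  polytope_compact : compact P ;
  polytope_nonempty : P !=set0 ;
  (* full-dimensional *)
  polytope_regular : closure P° = P ;
  polytope_connected : connected P°
}.

Definition boundary (R : realType) (d : nat) (P : set 'rV[R]_d) :
  set 'rV[R]_d := closure P `\` P°.

(* Interior of [F] relative to a hyperplane with normal vector [xi]. *)
Definition relint (R : realType) (d : nat) (xi : 'rV[R]_d) (F : set 'rV[R]_d) :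
  set 'rV[R]_d :=
  [set x | F x /\ \forall y \near x, dot xi (y - x) = 0 -> F y].

(* [n]-dimensional Lebesgue measure of a Borel set, by iterated integration
   over the coordinates (Tonelli). *)
Fixpoint lebesgue_rV (R : realType) (n : nat) : set 'rV[R]_n -> \bar R :=
  match n with
  | 0 => fun A => (\1_A 0)%:E
  | n'.+1 => fun A =>
      (\int[lebesgue_measure]_t
         lebesgue_rV [set y : 'rV[R]_n' | A (row_mx t%:M y)])%E
  end.

(* [L] is the [(d-1)]-dimensional Lebesgue measure of [F], a subset of a
   hyperplane with normal vector [xi], computed in an isometric chart
   [y |-> a + y E] of that hyperplane. *)
Definition hyperplane_measure (R : realType) (d : nat) (xi : 'rV[R]_d)
    (F : set 'rV[R]_d) (L : R) : Prop :=
  exists (a : 'rV[R]_d) (E : 'M[R]_(d.-1, d)),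
    [/\ E *m E^T = 1%:M,
        E *m xi^T = 0,
        F `<=` range (fun y : 'rV[R]_d.-1 => a + y *m E)
      & lebesgue_rV [set y : 'rV[R]_d.-1 | F (a + y *m E)] = L%:E].

(* [xi] is the unit outward normal vector of [P] along the facet [F]. *)
Definition outward_normal (R : realType) (d : nat) (P F : set 'rV[R]_d)
    (xi : 'rV[R]_d) : Prop :=
  [/\ enorm xi = 1,
      exists c : R, F `<=` [set x | dot xi x = c]
    & forall x, relint xi F x ->
        \forall t \near (0 : R)^'+, P° (x - t *: xi) /\ ~ P (x + t *: xi)].

(* [F j] are the edges ([d = 2]) or faces ([d = 3]) of the polytope [P], with
   unit outward normals [xi j] and [(d-1)]-dimensional measures [L j].
   Coplanar facets may be adjacent.  The last field says that the boundary does
   not intersect itself: a facet meets another one only along its relative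
   boundary. *)
Record facets (R : realType) (d J : nat) (P : set 'rV[R]_d)
    (F : 'I_J -> set 'rV[R]_d) (xi : 'I_J -> 'rV[R]_d) (L : 'I_J -> R) :
    Prop := {
  facets_boundary : boundary P = \bigcup_(j in [set: 'I_J]) F j ;
  facets_polyhedral : forall j, polyhedral (F j) ;
  facets_connected : forall j, connected (F j) ;
  facets_regular : forall j, closure (relint (xi j) (F j)) = F j ;
  facets_normal : forall j, outward_normal P (F j) (xi j) ;
  facets_measure_gt0 : forall j, 0 < L j ;
  facets_measure : forall j, hyperplane_measure (xi j) (F j) (L j) ;
  facets_simple : forall j k, j != k -> relint (xi j) (F j) `&` F k = set0
}.

(** * Relativistic magnetohydrodynamics *)

(* [h p rho] is the specific enthalpy. *)
Record equation_of_state (R : realType) (h : R -> R -> R) : Prop := {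
  eos_differentiable : forall p rho : R, 0 < p -> 0 < rho ->
    differentiable (fun z : R * R => h z.1 z.2) (p, rho) ;
  eos_lower_bound : forall p rho : R, 0 < p -> 0 < rho ->
    Num.sqrt (1 + p ^+ 2 / rho ^+ 2) + p / rho <= h p rho ;
  eos_derivatives : forall p rho : R, 0 < p -> 0 < rho ->
    h p rho * (rho^-1 - derive1 (fun q : R => h q rho) p) < derive1 (h p) rho /\
    derive1 (h p) rho < 0 ;
  eos_limit : forall rho : R, 0 < rho ->
    (fun p => h p rho) @ 0^'+ --> (1 : R)
}.

(* R^8, split as (D, m, B, E). *)
Notation state R := 'rV[R]_(1 + (3 + (3 + 1))).

Definition mk_state (R : realType) (D : R) (m B : 'rV[R]_3) (E : R) : state R :=
  row_mx D%:M (row_mx m (row_mx B E%:M)).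

Definition state_D (R : realType) (U : state R) : R := lsubmx U 0 0.

Definition state_B (R : realType) (U : state R) : 'rV[R]_3 :=
  lsubmx (rsubmx (rsubmx U)).

Record primitive (R : realType) := Primitive {
  density : R ;
  pressure : R ;
  velocity : 'rV[R]_3 ;
  magnetic : 'rV[R]_3
}.

(* Half of the squared magnetic field in the frame of velocity [v]; used both
   for p_m (where 1 - |v|^2 = W^-2) and for p_m^*. *)
Definition magnetic_pressure (R : realType) (v B : 'rV[R]_3) : R :=
  ((1 - enorm v ^+ 2) * enorm B ^+ 2 + dot v B ^+ 2) / 2.

Section Conservative.
Variables (R : realType) (h : R -> R -> R) (V : primitive R).

Let rho := density V.
Let p := pressure V.
Let v := velocity V.
Let B := magnetic V.

Definition lorentz : R := (Num.sqrt (1 - enorm v ^+ 2))^-1.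

Definition total_pressure : R := p + magnetic_pressure v B.

Definition admissible : Prop := [/\ 0 < rho, 0 < p & enorm v < 1].

Definition mass_density : R := rho * lorentz.

Definition momentum : 'rV[R]_3 :=
  (rho * h p rho * lorentz ^+ 2) *: v + enorm B ^+ 2 *: v - dot v B *: B.

Definition energy : R :=
  rho * h p rho * lorentz ^+ 2 - total_pressure + enorm B ^+ 2.

Definition conservative : state R := mk_state mass_density momentum B energy.

Definition flux (l : 'I_3) : state R :=
  mk_state (mass_density * v 0 l)
    (v 0 l *: momentum
      - B 0 l *: (lorentz ^- 2 *: B + dot v B *: v)
      + total_pressure *: delta_mx 0 l)
    (v 0 l *: B - B 0 l *: v)
    (momentum 0 l).

End Conservative.

Definition admissible_states (R : realType) (h : R -> R -> R) :
  set (state R) :=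
  [set U | exists V : primitive R, admissible V /\ U = conservative h V].

(* [prim] assigns to every admissible state U its primitive variables
   rho(U), p(U), v(U), B. *)
Definition primitive_recovery (R : realType) (h : R -> R -> R)
    (prim : state R -> primitive R) : Prop :=
  forall U, admissible_states h U ->
    admissible (prim U) /\ U = conservative h (prim U).

(* <xi, B> and <xi, F(U)>: for [d <= 3], [inord l : 'I_3] is the index [l < d]
   seen as one of the three coordinates. *)
Definition dir_magnetic (R : realType) (d : nat) (xi : 'rV[R]_d)
    (B : 'rV[R]_3) : R :=
  \sum_(l < d) xi 0 l * B 0 (inord l).

Definition dir_flux (R : realType) (h : R -> R -> R) (d : nat) (xi : 'rV[R]_d)
    (V : primitive R) : state R :=
  \sum_(l < d) xi 0 l *: flux h V (inord l).

Definition nstar (R : realType) (v B : 'rV[R]_3) : state R :=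
  mk_state (- Num.sqrt (1 - enorm v ^+ 2)) (- v)
    (- ((1 - enorm v ^+ 2) *: B) - dot v B *: v) 1.

Definition closed_admissible_states (R : realType) : set (state R) :=
  [set U | 0 < state_D U /\
    forall B v : 'rV[R]_3, enorm v < 1 ->
      0 <= dot U (nstar v B) + magnetic_pressure v B].

(* Main.v *)
(** Two ingredients: an inequality for one state, and the closing condition
    [\sum_j L j *: xi j = 0] of the polytope.

    With [w, C] for [v^*, B^*] and a unit vector [x], the expression
    [(U - <x, F(U)>) . n^* + p_m^* - ((x . w) p_m^* - (x . B) (w . C))]
    is the contraction of the energy-momentum and Faraday tensors with the
    light-like vector [(1, x)] and the four-velocity of [w].  It splits into a
    hydrodynamic part, nonnegative by the lower bound on the enthalpy, and a
    magnetic part which, multiplied by [2 (1 - x . w)], is a sum of squares.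
    Mixing [x] and [-x] gives the case of [alpha^-1 <= 1].  Averaging, the term in
    [x . B] vanishes by the discrete divergence-free condition and the term in
    [x . w] by the closing condition.

    For the closing condition, project along the [k]-th axis: [`|xi j 0 k| * L j] is
    the measure of the projection of the facet [F j], and on almost every line
    parallel to the axis entries into [P] and exits from [P] alternate, so that the
    signs of the [xi j 0 k] over the facets met by the line add up to zero. *)

Require Import Defs.
From HB Require Import structures.
From mathcomp Require Import all_boot all_order all_algebra.
From mathcomp Require Import all_classical all_reals all_analysis.
From mathcomp Require Import measurable_realfun ring lra.

Set Implicit Arguments.
Unset Strict Implicit.
Unset Printing Implicit Defensive.

Import Order.TTheory GRing.Theory Num.Theory numFieldNormedType.Exports.

Local Open Scope classical_set_scope.
Local Open Scope ring_scope.

(** * Euclidean inner product *)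

Lemma dotC (R : realType) n (u v : 'rV[R]_n) : dot u v = dot v u.
Proof. by apply: eq_bigr => i _; rewrite mulrC. Qed.

Lemma dotDl (R : realType) n (u v w : 'rV[R]_n) : dot (u + v) w = dot u w + dot v w.
Proof. by rewrite /dot -big_split; apply: eq_bigr => i _; rewrite mxE mulrDl. Qed.

Lemma dotZl (R : realType) n a (u v : 'rV[R]_n) : dot (a *: u) v = a * dot u v.
Proof. by rewrite /dot mulr_sumr; apply: eq_bigr => i _; rewrite mxE mulrA. Qed.

Lemma dotNl (R : realType) n (u v : 'rV[R]_n) : dot (- u) v = - dot u v.
Proof. by rewrite -scaleN1r dotZl mulN1r. Qed.

Lemma dotDr (R : realType) n (u v w : 'rV[R]_n) : dot w (u + v) = dot w u + dot w v.
Proof. by rewrite !(dotC w) dotDl. Qed.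

Lemma dotZr (R : realType) n a (u v : 'rV[R]_n) : dot u (a *: v) = a * dot u v.
Proof. by rewrite !(dotC u) dotZl. Qed.

Lemma dotNr (R : realType) n (u v : 'rV[R]_n) : dot u (- v) = - dot u v.
Proof. by rewrite !(dotC u) dotNl. Qed.

Lemma dot0l (R : realType) n (u : 'rV[R]_n) : dot 0 u = 0.
Proof. by rewrite -(scale0r 0) dotZl mul0r. Qed.

Lemma dot_suml (R : realType) n I (r : seq I) (P : pred I) (f : I -> 'rV[R]_n) u :
  dot (\sum_(i <- r | P i) f i) u = \sum_(i <- r | P i) dot (f i) u.
Proof.
elim/big_ind2 : _ => [|x a y b <- <-|//]; first exact: dot0l.
by rewrite dotDl.
Qed.

Lemma dot_delta (R : realType) n (u : 'rV[R]_n) k : dot (delta_mx 0 k) u = u 0 k.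
Proof.
rewrite /dot (bigD1 k) //= mxE !eqxx mul1r big1 ?addr0 // => i ik.
by rewrite mxE eqxx (negbTE ik) mul0r.
Qed.

Lemma dot_row_mx (R : realType) m n (a c : 'rV[R]_m) (b e : 'rV[R]_n) :
  dot (row_mx a b) (row_mx c e) = dot a c + dot b e.
Proof.
rewrite /dot big_split_ord /=; congr (_ + _); apply: eq_bigr => i _.
  by rewrite !row_mxEl.
by rewrite !row_mxEr.
Qed.

Lemma dot_ge0 (R : realType) n (u : 'rV[R]_n) : 0 <= dot u u.
Proof. by apply: sumr_ge0 => i _; rewrite -expr2 sqr_ge0. Qed.

Lemma enorm_sqr (R : realType) n (u : 'rV[R]_n) : enorm u ^+ 2 = dot u u.
Proof. by rewrite sqr_sqrtr ?dot_ge0. Qed.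

Lemma enorm_lt1 (R : realType) n (u : 'rV[R]_n) : enorm u < 1 -> dot u u < 1.
Proof.
rewrite -enorm_sqr => u1; rewrite -(expr1n R 2).
by rewrite ltr_pXn2r // nnegrE ?sqrtr_ge0.
Qed.

(** Expanding the square of [u - v] gives [2 * dot u v <= 1 + dot v v < 2]. *)
Lemma dot_lt1 (R : realType) n (u v : 'rV[R]_n) :
  dot u u = 1 -> dot v v < 1 -> dot u v < 1.
Proof.
move=> u1 v1.
have := dot_ge0 (u - v); rewrite !(dotDl, dotDr, dotNl, dotNr) (dotC v u) u1.
lra.
Qed.

(** * The inequality for a single state *)

(* The Minkowski Gram determinant of [(1, v)], [(1, x)], [(1, w)], [(0, B)],
   expanded along its first two rows, is minus the square of the 4 x 4
   determinant of these vectors. *)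
Lemma minkowski_gram_le0 (R : realType) (x v w B : 'rV[R]_3) :
  ((dot v v - 1) * (dot x x - 1) - (dot x v - 1) * (dot x v - 1)) *
       ((dot w w - 1) * dot B B - dot w B * dot w B)
   - ((dot v v - 1) * (dot x w - 1) - (dot x v - 1) * (dot v w - 1)) *
       ((dot x w - 1) * dot B B - dot x B * dot w B)
   + ((dot v v - 1) * dot x B - (dot x v - 1) * dot v B) *
       ((dot x w - 1) * dot w B - dot x B * (dot w w - 1))
   + ((dot x v - 1) * (dot x w - 1) - (dot x x - 1) * (dot v w - 1)) *
       ((dot v w - 1) * dot B B - dot v B * dot w B)
   - ((dot x v - 1) * dot x B - (dot x x - 1) * dot v B) *
       ((dot v w - 1) * dot w B - dot v B * (dot w w - 1))
   + ((dot v w - 1) * dot x B - (dot x w - 1) * dot v B) *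
       ((dot v w - 1) * dot x B - dot v B * (dot x w - 1)) <= 0.
Proof.
rewrite /dot !big_ord_recl !big_ord0 /=.
set i0 := ord0; set i1 := lift _ _; set i2 := lift _ _.
move: (x _ i0) (x _ i1) (x _ i2) (v _ i0) (v _ i1) (v _ i2).
move: (w _ i0) (w _ i1) (w _ i2) (B _ i0) (B _ i1) (B _ i2).
move=> w1 w2 w3 B1 B2 B3 x1 x2 x3 v1 v2 v3.
set t := (leLHS).
have -> : t = - ((x1 - v1) * ((w2 - v2) * B3 - (w3 - v3) * B2)
                 - (x2 - v2) * ((w1 - v1) * B3 - (w3 - v3) * B1)
                 + (x3 - v3) * ((w1 - v1) * B2 - (w2 - v2) * B1)) ^+ 2.
  by rewrite /t; ring.
by rewrite oppr_le0 sqr_ge0.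
Qed.

(* Here [x] is a light-like direction.  Covariantly, the magnetic part is quadratic
   in the comoving field of [(w, C)]; completing the square produces [Y], and what
   remains is a Gram determinant. *)
Lemma magnetic_ge0 (R : realType) (x v B w C : 'rV[R]_3) :
  dot x x = 1 -> dot w w < 1 ->
  let pm := ((1 - dot v v) * dot B B + dot v B ^+ 2) / 2 in
  let pw := ((1 - dot w w) * dot C C + dot w C ^+ 2) / 2 in
  let mw := dot B B * dot v w - dot v B * dot w B in
  let BC := (1 - dot w w) * dot B C + dot w C * dot w B in
  let vC := (1 - dot w w) * dot v C + dot w C * dot v w in
  0 <= dot B B - pm - mw - BC + pw
       - (dot B B * dot x v - dot v B * dot x B
          - (dot x v * mw - dot x B * ((1 - dot v v) * dot w B + dot v B * dot v w)
             + pm * dot x w)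
          - (dot x v * BC - dot x B * vC))
       - (dot x w * pw - dot x B * dot w C).
Proof.
move=> x1 w1 /=; set t := (leRHS).
have b0 : 0 < 1 - dot x w by rewrite subr_gt0 dot_lt1.
pose Y := (1 - dot x w) *: C - (1 - dot x v) *: B + dot x B *: (w - v).
have := minkowski_gram_le0 x v w B; rewrite x1; set G := (leLHS) => G0.
have tE : 2 * (1 - dot x w) * t = (1 - dot w w) * dot Y Y + dot Y w ^+ 2 - G.
  rewrite /t /G /Y !(dotDl, dotDr, dotNl, dotNr, dotZl, dotZr).
  rewrite ?(dotC w x) ?(dotC v x) ?(dotC B x) ?(dotC w v) ?(dotC B v).
  rewrite ?(dotC B w) ?(dotC C w) ?(dotC C v) ?(dotC C B).
  by field.
have : 0 <= 2 * (1 - dot x w) * t.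
  by rewrite tE !addr_ge0 ?sqr_ge0 ?mulr_ge0 ?dot_ge0 ?oppr_ge0 // subr_ge0 ltW.
by rewrite pmulr_rge0 // mulr_gt0.
Qed.

(** The difference of the two sides is the Minkowski Gram determinant of [(1, v)], [(1, x)] and
    [(1, w)], nonnegative because [(1, w)] is time-like. *)
Lemma gram_lorentz_ge0 (R : realType) (x v w : 'rV[R]_3) :
  dot x x = 1 -> dot w w < 1 ->
  (1 - dot w w) * (1 - dot x v) ^+ 2 + (1 - dot v v) * (1 - dot x w) ^+ 2
  <= 2 * (1 - dot x v) * (1 - dot v w) * (1 - dot x w).
Proof.
move=> x1 w1; rewrite -subr_ge0; set t := (leRHS).
have b0 : 0 < 1 - dot x w by rewrite subr_gt0 dot_lt1.
have c0 : 0 < 1 - dot w w by rewrite subr_gt0.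
(* Up to the factor [(1 - dot x w) ^+ 2], [Z] is the component of [(1, v)] Minkowski-orthogonal to
   [(1, x)] and [(1, w)], reduced modulo [(1, w)] to a purely spatial vector. *)
pose Z := (1 - dot x w) ^+ 2 *: (v - w)
  - ((1 - dot x w) * (1 - dot v w) - (1 - dot w w) * (1 - dot x v)) *: (x - w).
have tE : (1 - dot w w) * (1 - dot x w) ^+ 2 * t
          = (1 - dot w w) * dot Z Z + dot Z w ^+ 2.
  rewrite /t /Z !(dotDl, dotDr, dotNl, dotNr, dotZl, dotZr) x1.
  rewrite ?(dotC w x) ?(dotC v x) ?(dotC w v).
  ring.
have : 0 <= (1 - dot w w) * (1 - dot x w) ^+ 2 * t.
  by rewrite tE addr_ge0 ?sqr_ge0 // mulr_ge0 ?dot_ge0 // ltW.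
by rewrite pmulr_rge0 // mulr_gt0 // exprn_gt0.
Qed.

(** The hypothesis bounds [rho * h - p] from below by the square root of [rho ^+ 2 + p ^+ 2]. This
    root exceeds [p], which gives the first claim; squaring gives the second. *)
Lemma enthalpy_bound (R : realType) (rho p h : R) : 0 < rho -> 0 < p ->
  Num.sqrt (1 + p ^+ 2 / rho ^+ 2) + p / rho <= h ->
  2 * p < rho * h /\ rho ^+ 2 <= rho * h * (rho * h - 2 * p).
Proof.
move=> rho0 p0 hh.
have r2 : 0 < rho ^+ 2 by rewrite exprn_gt0.
have e0 : 0 < p ^+ 2 / rho ^+ 2 by rewrite divr_gt0 // exprn_gt0.
set S := Num.sqrt _ in hh.
have S2 : (rho * S) ^+ 2 = rho ^+ 2 + p ^+ 2.
  by rewrite exprMn sqr_sqrtr; [field; rewrite gt_eqF|lra].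
have S0 : 0 <= rho * S by rewrite mulr_ge0 ?sqrtr_ge0 // ltW.
have H : rho * S + p <= rho * h.
  have -> : rho * S + p = rho * (S + p / rho) by field; rewrite gt_eqF.
  by rewrite ler_pM2l.
have pS : p < rho * S.
  by rewrite -(@ltr_pXn2r _ 2) ?nnegrE ?(ltW p0) // S2 ltrDr.
split; first lra.
have : (rho * S) ^+ 2 <= (rho * h - p) ^+ 2.
  by rewrite ler_pXn2r ?nnegrE //; lra.
rewrite S2; nra.
Qed.

(** The hydrodynamic part of the contraction; [s] and [t] are the inverse Lorentz factors of [v] and
    [w]. *)
Lemma hydro_ge0 (R : realType) (x v w : 'rV[R]_3) (rho p h s t : R) :
  dot x x = 1 -> 0 < rho -> 0 < p -> 0 < s -> 0 < t ->
  s ^+ 2 = 1 - dot v v -> t ^+ 2 = 1 - dot w w ->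
  Num.sqrt (1 + p ^+ 2 / rho ^+ 2) + p / rho <= h ->
  0 <= rho * h / s ^+ 2 * (1 - dot v w) * (1 - dot x v) - p * (1 - dot x w)
       - rho / s * t * (1 - dot x v).
Proof.
move=> x1 rho0 p0 s0 t0 sE tE hh.
have [H2 H1] := enthalpy_bound rho0 p0 hh.
have w1 : dot w w < 1 by rewrite -subr_gt0 -tE exprn_gt0.
have b0 : 0 < 1 - dot x w by rewrite subr_gt0 dot_lt1.
have := gram_lorentz_ge0 v x1 w1; rewrite -sE -tE.
move: H2 H1 b0; set H := rho * h; set a := 1 - dot x v; set b := 1 - dot x w.
set g := 1 - dot v w => H2 H1 b0 G.
have Hp : 0 < H - 2 * p by rewrite subr_gt0.
set T := (leRHS).
(* This positive factor clears the denominators and lets a square be completed. The three resulting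
   terms are nonnegative by the Gram inequality, as a square, and by the enthalpy bound. *)
suff : 0 <= (H - 2 * p) * (2 * b * s ^+ 2) * T.
  by rewrite pmulr_rge0 // !mulr_gt0 // exprn_gt0.
have -> : (H - 2 * p) * (2 * b * s ^+ 2) * T =
  (H - 2 * p) * H * (2 * a * g * b - (t ^+ 2 * a ^+ 2 + s ^+ 2 * b ^+ 2)) +
  (((H - 2 * p) * (s * b) - rho * (t * a)) ^+ 2
   + (H * (H - 2 * p) - rho ^+ 2) * (t * a) ^+ 2).
  by rewrite /T; field; rewrite gt_eqF.
have H0 : 0 <= H by lra.
apply: addr_ge0; last by rewrite addr_ge0 ?sqr_ge0 // mulr_ge0 ?sqr_ge0 ?subr_ge0 // mulrC.
by rewrite mulr_ge0 ?subr_ge0 // mulr_ge0 // ltW.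
Qed.

Lemma dot_mk_state (R : realType) D m B E D' m' B' E' :
  dot (mk_state D m B E : state R) (mk_state D' m' B' E')
  = D * D' + dot m m' + dot B B' + E * E'.
Proof.
have dot1 (a b : R) : dot (a%:M : 'rV_1) b%:M = a * b.
  by rewrite /dot big_ord1 !mxE !mulr1n.
by rewrite /mk_state !dot_row_mx !dot1 !addrA.
Qed.

Lemma dot_flux_nstar (R : realType) (h : R -> R -> R) V (x w C : 'rV[R]_3) :
  dot (\sum_l x 0 l *: flux h V l) (nstar w C) =
  let v := velocity V in let B := magnetic V in let m := momentum h V in
  - (mass_density V * Num.sqrt (1 - enorm w ^+ 2) * dot x v)
  - (dot x v * dot m w - dot x B * (lorentz V ^- 2 * dot w B + dot v B * dot v w)
     + total_pressure V * dot x w)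
  - (dot x v * ((1 - enorm w ^+ 2) * dot B C + dot w C * dot w B)
     - dot x B * ((1 - enorm w ^+ 2) * dot v C + dot w C * dot v w))
  + dot x m.
Proof.
cbv zeta; rewrite /flux; move: (momentum h V) => m.
set v := velocity V; set B := magnetic V.
rewrite dot_suml; under eq_bigr => l _.
  rewrite dotZl /nstar dot_mk_state.
  rewrite !(dotDl, dotDr, dotNl, dotNr, dotZl, dotZr) dot_delta.
  rewrite (dotC B w) mulr1.
  over.
(* Each summand is [x 0 l] times a combination of the [l]-th coordinates of [v], [B], [w] and [m],
   so the sum splits into one [f] per vector. *)
pose f (k : R) (u : 'rV[R]_3) := \sum_l x 0 l * (k * u 0 l).
have fE k u : f k u = k * dot x u.
  by rewrite /f /dot mulr_sumr; apply: eq_bigr => l _; rewrite mulrCA.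
transitivity (f (- (mass_density V * Num.sqrt (1 - enorm w ^+ 2)) - dot m w
    - ((1 - enorm w ^+ 2) * dot B C + dot w C * dot w B)) v
  + f (lorentz V ^- 2 * dot w B + dot v B * dot v w
       + ((1 - enorm w ^+ 2) * dot v C + dot w C * dot v w)) B
  + f (- total_pressure V) w + f 1 m).
  rewrite /f -!big_split; apply: eq_bigr => l _ /=.
  by ring.
by rewrite !fE; ring.
Qed.

Lemma flux_bound_sphere (R : realType) (h : R -> R -> R) (V : primitive R)
    (x w C : 'rV[R]_3) :
  (forall p rho : R, 0 < p -> 0 < rho ->
    Num.sqrt (1 + p ^+ 2 / rho ^+ 2) + p / rho <= h p rho) ->
  admissible V -> dot x x = 1 -> enorm w < 1 ->
  0 <= dot (conservative h V - \sum_l x 0 l *: flux h V l) (nstar w C)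
       + magnetic_pressure w C
       - (dot x w * magnetic_pressure w C - dot x (magnetic V) * dot w C).
Proof.
case: V => rho p v B hh [/= rho0 p0 v1] x1 w1.
have vv1 := enorm_lt1 v1; have ww1 := enorm_lt1 w1.
rewrite dotDl dotNl dot_flux_nstar /= /conservative /nstar dot_mk_state.
rewrite /momentum /energy /total_pressure /mass_density /magnetic_pressure /lorentz /=.
rewrite !enorm_sqr.
have s0 : 0 < 1 - dot v v by rewrite subr_gt0.
have t0 : 0 < 1 - dot w w by rewrite subr_gt0.
have sE := sqr_sqrtr (ltW s0); have tE := sqr_sqrtr (ltW t0).
have s1 : 0 < Num.sqrt (1 - dot v v) by rewrite sqrtr_gt0.
have t1 : 0 < Num.sqrt (1 - dot w w) by rewrite sqrtr_gt0.
move: sE tE s1 t1; set s := Num.sqrt (1 - dot v v); set t := Num.sqrt (1 - dot w w) => sE tE s1 t1.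
rewrite !(dotDl, dotDr, dotNl, dotNr, dotZl, dotZr) exprVn invrK sE.
have H := hydro_ge0 x1 rho0 p0 s1 t1 sE tE (hh _ _ p0 rho0); rewrite sE in H.
have M := magnetic_ge0 v B C x1 ww1.
rewrite ?(dotC B w).
(* The two parts add up to the goal exactly, so only an identity is left. *)
apply: le_trans (addr_ge0 H M) _; rewrite le_eqVlt; apply/orP; left; apply/eqP.
field.
by rewrite !gt_eqF.
Qed.

(** The flux and the correction are odd in [x]: the claim is the combination of the bounds for [x]
    and [- x] with weights [(1 + b) / 2] and [(1 - b) / 2]. *)
Lemma flux_bound (R : realType) (h : R -> R -> R) (V : primitive R)
    (x w C : 'rV[R]_3) (b : R) :
  (forall p rho : R, 0 < p -> 0 < rho ->
    Num.sqrt (1 + p ^+ 2 / rho ^+ 2) + p / rho <= h p rho) ->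
  admissible V -> dot x x = 1 -> enorm w < 1 -> 0 <= b <= 1 ->
  0 <= dot (conservative h V - b *: \sum_l x 0 l *: flux h V l) (nstar w C)
       + magnetic_pressure w C
       - b * (dot x w * magnetic_pressure w C - dot x (magnetic V) * dot w C).
Proof.
move=> hh adm x1 w1 /andP[b0 b1].
have xN1 : dot (- x) (- x) = 1 by rewrite dotNl dotNr opprK.
have := flux_bound_sphere C hh adm x1 w1.
have := flux_bound_sphere C hh adm xN1 w1.
have -> : \sum_l (- x) 0 l *: flux h V l = - \sum_l x 0 l *: flux h V l.
  by rewrite -sumrN; apply: eq_bigr => l _; rewrite mxE scaleNr.
rewrite !(dotDl, dotNl, dotZl).
nra.
Qed.

(** * Normals of [R^d] as vectors of [R^3], and the averaging argument *)

(** Padding with zeros lets [d = 2] and [d = 3] share the three-dimensional inequalities. *)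
Definition pad3 (R : realType) d (x : 'rV[R]_d) : 'rV[R]_3 :=
  \sum_(l < d) x 0 l *: delta_mx 0 (inord l).

Lemma pad3E (R : realType) d (x : 'rV[R]_d) (i : 'I_3) :
  pad3 x 0 i = \sum_(l < d) x 0 l *+ (i == inord l).
Proof.
rewrite /pad3 summxE; apply: eq_bigr => l _.
by rewrite !mxE eqxx /= mulr_natr.
Qed.

Lemma dot_pad3 (R : realType) d (x : 'rV[R]_d) (B : 'rV[R]_3) :
  dot (pad3 x) B = dir_magnetic x B.
Proof.
by rewrite /pad3 dot_suml; apply: eq_bigr => l _; rewrite dotZl dot_delta.
Qed.

Lemma pad3_inord (R : realType) d (x : 'rV[R]_d) (l : 'I_d) :
  (d <= 3)%N -> pad3 x 0 (inord l) = x 0 l.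
Proof.
move=> d3; rewrite pad3E (bigD1 l) //= eqxx big1 ?addr0 // => k kl.
rewrite (_ : (inord l == inord k :> 'I_3) = false) //.
apply/negbTE; apply: contra kl => /eqP/(congr1 val) /=.
by rewrite !inordK ?(leq_trans (ltn_ord _)) // => lk; apply/eqP/val_inj.
Qed.

Lemma dot_pad3_self (R : realType) d (x : 'rV[R]_d) :
  (d <= 3)%N -> dot (pad3 x) (pad3 x) = dot x x.
Proof.
by move=> d3; rewrite dot_pad3; apply: eq_bigr => l _; rewrite pad3_inord.
Qed.

Lemma dir_flux_pad3 (R : realType) (h : R -> R -> R) d (x : 'rV[R]_d) V :
  dir_flux h x V = \sum_i pad3 x 0 i *: flux h V i.
Proof.
under [RHS]eq_bigr => i _ do rewrite pad3E scaler_suml.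
rewrite exchange_big; apply: eq_bigr => l _ /=.
rewrite (bigD1 (inord l)) //= eqxx mulr1n big1 ?addr0 // => i /negbTE ->.
by rewrite mulr0n scale0r.
Qed.

Lemma pad3_sum (R : realType) d J (L : 'I_J -> R) (x : 'I_J -> 'rV[R]_d) :
  \sum_j L j *: x j = 0 -> \sum_j L j *: pad3 (x j) = 0.
Proof.
move=> /rowP s0; rewrite /pad3.
under eq_bigr => j _ do rewrite scaler_sumr.
rewrite exchange_big big1 // => l _ /=.
under eq_bigr => j _ do rewrite scalerA.
rewrite -scaler_suml; have := s0 l; rewrite mxE summxE => sl.
rewrite (_ : \sum_j _ = 0) ?scale0r // -[RHS]sl.
by apply: eq_bigr => j _; rewrite mxE.
Qed.

Lemma state_D_conservative (R : realType) (h : R -> R -> R) V :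
  state_D (conservative h V) = mass_density V.
Proof. by rewrite /state_D row_mxKl mxE mulr1n. Qed.

Lemma state_B_conservative (R : realType) (h : R -> R -> R) V :
  state_B (conservative h V) = magnetic V.
Proof. by rewrite /state_B !row_mxKr row_mxKl. Qed.

Lemma state_D_flux (R : realType) (h : R -> R -> R) V l :
  state_D (flux h V l) = mass_density V * velocity V 0 l.
Proof. by rewrite /state_D row_mxKl mxE mulr1n. Qed.

Lemma state_D_lincomb (R : realType) I (r : seq I) (a : I -> R) (f : I -> state R) :
  state_D (\sum_(i <- r) a i *: f i) = \sum_(i <- r) a i * state_D (f i).
Proof.
rewrite /state_D linear_sum summxE; apply: eq_bigr => i _.
by rewrite linearZ mxE.
Qed.

(** The density component equals [mass_density V * (1 - b * dot x (velocity V))], and the inner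
    product is less than 1. *)
Lemma state_D_bound (R : realType) (h : R -> R -> R) (V : primitive R)
    (x : 'rV[R]_3) (b : R) :
  admissible V -> dot x x = 1 -> 0 <= b <= 1 ->
  0 < state_D (conservative h V - b *: \sum_l x 0 l *: flux h V l).
Proof.
move=> [rho0 _ v1] x1 /andP[b0 b1].
have vv1 := enorm_lt1 v1.
have D0 : 0 < mass_density V.
  by rewrite /mass_density mulr_gt0 // invr_gt0 sqrtr_gt0 enorm_sqr subr_gt0.
have state_DB (a c : state R) : state_D (a - b *: c) = state_D a - b * state_D c.
  by rewrite /state_D !mxE.
rewrite state_DB state_D_lincomb state_D_conservative.
under eq_bigr => l _ do rewrite state_D_flux mulrCA.
rewrite -mulr_sumr -/(dot x (velocity V)).
have xv := dot_lt1 x1 vv1.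
rewrite mulrCA -[X in X - _]mulr1 -mulrBr mulr_gt0 //.
move: b0; rewrite le_eqVlt => /predU1P[<-|b0]; first by rewrite mul0r subr0.
have : 0 < b * (1 - dot x (velocity V)) by rewrite mulr_gt0 // subr_gt0.
lra.
Qed.

Lemma average_admissible (R : realType) (h : R -> R -> R)
    (d J Q : nat) (xi : 'I_J -> 'rV[R]_d) (L : 'I_J -> R) (omega : 'I_Q -> R)
    (V : 'I_Q -> 'I_J -> primitive R) (alpha : R) :
  (forall p rho : R, 0 < p -> 0 < rho ->
    Num.sqrt (1 + p ^+ 2 / rho ^+ 2) + p / rho <= h p rho) ->
  (d <= 3)%N -> (forall j, enorm (xi j) = 1) -> (forall j, 0 < L j) ->
  0 < \sum_j L j -> \sum_j L j *: xi j = 0 ->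
  (forall i, 0 < omega i) -> \sum_i omega i = 1 ->
  (forall i j, admissible (V i j)) ->
  \sum_j (\sum_i omega i * dir_magnetic (xi j) (magnetic (V i j))) * L j = 0 ->
  1 <= alpha ->
  closed_admissible_states
    ((\sum_(j < J) L j)^-1 *:
      \sum_(j < J) L j *:
        \sum_(i < Q) omega i *:
          (conservative h (V i j) - alpha^-1 *: dir_flux h (xi j) (V i j))).
Proof.
move=> hh d3 xi1 L0 sL closed om0 om1 adm divB alpha1.
have b01 : 0 <= alpha^-1 <= 1.
  have a0 : 0 < alpha by rewrite (lt_le_trans _ alpha1).
  by rewrite invr_ge0 (ltW a0) invf_le1.
have x1 j : dot (pad3 (xi j)) (pad3 (xi j)) = 1.
  by rewrite dot_pad3_self // -enorm_sqr xi1 expr1n.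
set b := alpha^-1 in b01 *.
set f := fun i j => conservative h (V i j) - b *: dir_flux h (xi j) (V i j).
(* Strict positivity of the averaged density needs nonempty index sets; they come from the positive
   total measure and from the weights adding up to 1. *)
have J0 : (0 < J)%N.
  by case: J xi L V sL {closed divB f L0 xi1 adm x1} => // xi L V; rewrite big_ord0 ltxx.
have Q0 : (0 < Q)%N.
  by case: Q omega om1 {om0 V f adm divB} => // omega; rewrite big_ord0 => /esym/eqP; rewrite oner_eq0.
split.
  rewrite /state_D linearZ mxE -/(state_D _) mulr_gt0 ?invr_gt0 //.
  rewrite state_D_lincomb.
  have psum n (g : 'I_n -> R) : (0 < n)%N -> (forall i, 0 < g i) -> 0 < \sum_i g i.
    case: n g => // n g _ g0; rewrite big_ord_recl ltr_pwDl // sumr_ge0 // => i _.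
    exact: ltW.
  apply: (psum _ _ J0) => j; rewrite mulr_gt0 // state_D_lincomb.
  apply: (psum _ _ Q0) => i; rewrite mulr_gt0 // /f dir_flux_pad3.
  exact: state_D_bound.
move=> C w w1; set n := nstar w C; set pm := magnetic_pressure w C.
have fb i j : 0 <= dot (f i j) n + pm
    - b * (dot (pad3 (xi j)) w * pm - dir_magnetic (xi j) (magnetic (V i j)) * dot w C).
  by rewrite -dot_pad3 /f dir_flux_pad3; exact: flux_bound.
rewrite dotZl -(pmulr_rge0 _ sL) mulrDr mulrA mulfV ?gt_eqF // mul1r.
have -> : dot (\sum_j L j *: \sum_i omega i *: f i j) n + (\sum_j L j) * pm =
  \sum_j L j * \sum_i omega i * (dot (f i j) n + pm
    - b * (dot (pad3 (xi j)) w * pm - dir_magnetic (xi j) (magnetic (V i j)) * dot w C)).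
  (* The subtracted term is zero, its first part by the closing condition and its second by [divB].
     Distributed over the sum, it turns each summand into the nonnegative quantity of [fb]. *)
  transitivity (\sum_j L j * \sum_i omega i * dot (f i j) n + (\sum_j L j) * pm
     - b * (dot (\sum_j L j *: pad3 (xi j)) w * pm
        - \sum_j (\sum_i omega i * dir_magnetic (xi j) (magnetic (V i j))) * L j * dot w C)).
    rewrite -mulr_suml divB pad3_sum // dot0l !mul0r subr0 mulr0 subr0; congr (_ + _).
    rewrite dot_suml; apply: eq_bigr => j _; rewrite dotZl dot_suml; congr (_ * _).
    by apply: eq_bigr => i _; rewrite dotZl.
  rewrite dot_suml !mulr_suml -sumrB mulr_sumr -big_split -sumrB /=.
  apply: eq_bigr => j _.
  under [in RHS]eq_bigr => i _ do rewrite mulrBr mulrDr.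
  rewrite sumrB big_split /= -mulr_suml om1 mul1r dotZl.
  have -> : \sum_i omega i * (b * (dot (pad3 (xi j)) w * pm
      - dir_magnetic (xi j) (magnetic (V i j)) * dot w C)) =
    b * ((\sum_i omega i) * dot (pad3 (xi j)) w * pm
      - (\sum_i omega i * dir_magnetic (xi j) (magnetic (V i j))) * dot w C).
    move: (dot _ w) => xw.
    rewrite !mulr_suml -sumrB mulr_sumr; apply: eq_bigr => i _.
    by ring.
  rewrite om1.
  ring.
apply: sumr_ge0 => j _; rewrite mulr_ge0 ?(ltW (L0 j)) //.
by apply: sumr_ge0 => i _; rewrite mulr_ge0 ?(ltW (om0 i)).
Qed.

(** * Affine changes of variables on the line and in the plane *)

Section LinearImage.
Variable R : realType.
Notation T := (measurableTypeR R).
Notation mu := (@lebesgue_measure R).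
Notation mu2 := (mu \x mu)%E.

Lemma measurable_fun_affine (b m : R) :
  measurable_fun [set: T] ((fun t => b + m * t) : T -> T).
Proof. by apply: measurable_funD => //; apply: measurable_funM. Qed.

Lemma affine_preimage_itv (b m x y : R) : m != 0%R ->
  (fun t : R => b + m * t) @^-1` `]x, y]%classic =
  if (0 < m)%R then `](x - b) / m, (y - b) / m]%classic
  else `[(y - b) / m, (x - b) / m[%classic.
Proof.
move=> m0; apply/seteqP; case: ifPn => [mp|]; last rewrite -leNgt le_eqVlt (negbTE m0) /= => mn.
  by split=> t /=; rewrite !in_itv /= ltr_pdivrMr // ler_pdivlMr // ltrBlDl lerBrDl (mulrC t).
by split=> t /=; rewrite !in_itv /= ltr_ndivlMr // ler_ndivrMr // ltrBlDl lerBrDl (mulrC t) andbC.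
Qed.

(** The scaled pushforward gives every half-open interval its length, so it is the Lebesgue measure
    by uniqueness. *)
Lemma lebesgue_measure_affine (b m : R) (S : set T) : m != 0%R -> measurable S ->
  (`|m|%:E * mu [set t | S (b + m * t)%R] = mu S)%E.
Proof.
move=> m0 mS.
have m_ge0 : (0 <= `|m|)%R by [].
have mf := measurable_fun_affine b m.
pose f : T -> T := fun t => b + m * t.
pose nu := mscale (NngNum m_ge0) (pushforward mu f).
transitivity (nu mf S); first by [].
rewrite /nu; apply/esym/lebesgue_measure_unique => // _ [[x y] _ <-] /=.
rewrite /mscale /= /pushforward /= affine_preimage_itv //.
rewrite [LHS]lebesgue_measure_itv /= lte_fin.
have [mp|mn|/eqP] := ltgtP 0 m; last by rewrite eq_sym (negbTE m0).
  rewrite lebesgue_measure_itv /= lte_fin ltr_pM2r ?invr_gt0 // ltrD2r.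
  case: ifPn => xy; last by rewrite mule0.
  by rewrite gtr0_norm // -!EFinB -EFinM; congr EFin; field.
rewrite lebesgue_measure_itv /= lte_fin ltr_nM2r ?invr_lt0 // ltrD2r.
case: ifPn => xy; last by rewrite mule0.
by rewrite ltr0_norm // -!EFinB -EFinM; congr EFin; field.
Qed.

(** Both iterated measures agree on rectangles; this allows slicing in either direction. *)
Lemma product_lebesgueC (S : set (T * T)) : measurable S -> mu2 S = (mu \x^ mu)%E S.
Proof.
move=> mS; apply: product_measure_unique => // A B mA mB.
exact: product_measure2E.
Qed.

Lemma measurable_preimageT d1 d2 (X : measurableType d1) (Y : measurableType d2)
  (f : X -> Y) (S : set Y) :
  measurable_fun setT f -> measurable S -> measurable (f @^-1` S).
Proof. by move=> mf mS; rewrite -[X in measurable X]setTI; apply: mf. Qed.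

Lemma measurable_fun_affine2 (b c d : R) :
  measurable_fun [set: T * T] ((fun z => b + c * z.1 + d * z.2) : T * T -> T).
Proof.
by apply: measurable_funD; [apply: measurable_funD => //|]; apply: measurable_funM.
Qed.

Lemma measurable_shear1 (b c d : R) (S : set (T * T)) : measurable S ->
  measurable [set z : T * T | S (z.1, b + c * z.1 + d * z.2)].
Proof.
move=> mS; apply: measurable_preimageT mS.
by apply: measurable_fun_pair => //; exact: measurable_fun_affine2.
Qed.

Lemma measurable_shear2 (a b c : R) (S : set (T * T)) : measurable S ->
  measurable [set z : T * T | S (b + a * z.1 + c * z.2, z.2)].
Proof.
move=> mS; apply: measurable_preimageT mS.
by apply: measurable_fun_pair => //; exact: measurable_fun_affine2.
Qed.

(** On each slice with fixed first coordinate the shear is a one-dimensional affine map of slope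
    [d]. *)
Lemma lebesgue2_shear1 (b c d : R) (S : set (T * T)) : d != 0 -> measurable S ->
  (`|d|%:E * mu2 [set z | S (z.1, b + c * z.1 + d * z.2)%R] = mu2 S)%E.
Proof.
move=> d0 mS; have mS' := measurable_shear1 b c d mS.
rewrite /product_measure1 -ge0_integralZl ?lee_fin //; last first.
  by apply: measurable_fun_xsection.
apply: eq_integral => t _ /=.
have mSt := measurable_xsection t mS.
by rewrite -(@lebesgue_measure_affine (b + c * t) d (xsection S t)).
Qed.

Lemma lebesgue2_shear2 (a b c : R) (S : set (T * T)) : a != 0 -> measurable S ->
  (`|a|%:E * mu2 [set z | S (b + a * z.1 + c * z.2, z.2)%R] = mu2 S)%E.
Proof.
move=> a0 mS; have mS' := measurable_shear2 a b c mS.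
rewrite !product_lebesgueC // /product_measure2 -ge0_integralZl ?lee_fin //; last first.
  by apply: measurable_fun_ysection.
apply: eq_integral => s _ /=.
have mSs := measurable_ysection s mS.
rewrite -(@lebesgue_measure_affine (b + c * s) a (ysection S s)) //=.
by congr (_ * mu _)%E; apply/seteqP; split=> t; rewrite /ysection /= !inE /= addrAC.
Qed.

Lemma lebesgue2_affine (a b c d e f : R) (S : set (T * T)) :
  a * d - b * c != 0 -> measurable S ->
  (`|a * d - b * c|%:E *
    mu2 [set z | S (e + a * z.1 + c * z.2, f + b * z.1 + d * z.2)%R] = mu2 S)%E.
Proof.
(* If [d = 0] then [b] is nonzero, and composing with the measure-preserving shear
   [(z.1 + z.2, z.2)] reduces to the entries [c - a] and [d - b], the latter nonzero. *)
wlog d0 : a b c d e f / d != 0 => [wlog_d|] det0 mS.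
  have [d0|] := eqVneq d 0; last by move=> d0; exact: wlog_d.
  have b0 : b != 0 by apply: contraNneq det0 => ->; rewrite d0 mulr0 mul0r subrr.
  have detE : a * (d - b) - b * (c - a) = a * d - b * c by ring.
  have dN : d - b != 0 by rewrite d0 sub0r oppr_eq0.
  have mS' : measurable [set z : T * T |
      S (e + a * z.1 + (c - a) * z.2, f + b * z.1 + (d - b) * z.2)].
    apply: measurable_preimageT mS.
    by apply: measurable_fun_pair; exact: measurable_fun_affine2.
  rewrite -(wlog_d a b (c - a) (d - b) e f) ?detE //.
  rewrite -(@lebesgue2_shear2 1 0 1 _ _ mS') ?oner_eq0 // normr1 mul1e.
  congr (_ * mu2 _)%E; apply/funext => z /=; congr (S (_, _)); ring.
(* The map is a shear of the second coordinate followed by one of the first, whose slope is the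
   Schur complement [a - c * b / d]. *)
have a'0 : a - c * b / d != 0.
  rewrite (_ : a - c * b / d = (a * d - b * c) / d); last by field.
  by rewrite mulf_neq0 // invr_eq0.
have mS' := measurable_shear2 (a - c * b / d) (e - c * f / d) (c / d) mS.
rewrite -(lebesgue2_shear2 (e - c * f / d) (c / d) a'0 mS).
rewrite -(lebesgue2_shear1 f b d0 mS') muleA -EFinM -normrM.
have -> : (a - c * b / d) * d = a * d - b * c by field.
congr (_ * mu2 _)%E; apply/funext => z /=; congr (S (_, _)); field => //.
Qed.

End LinearImage.

(** * Iterated Lebesgue measure on [R^1] and [R^2] *)

Lemma det_mx22 (R : comPzRingType) (M : 'M[R]_2) :
  \det M = M 0 0 * M 1 1 - M 0 1 * M 1 0.
Proof.
rewrite (expand_det_row _ 0) big_ord_recl big_ord1 /cofactor !det_mx11 !mxE /=.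
rewrite addn0 expr0 mul1r expr1 mulN1r mulrN.
by congr (_ * M _ _ - M _ _ * M _ _); exact: val_inj.
Qed.

Section LebesgueRV.
Variable R : realType.
Notation T := (measurableTypeR R).
Notation mu := (@lebesgue_measure R).
Notation mu2 := (mu \x mu)%E.

(** The trailing empty block makes [vec1] and [vec2] match the recursion of [lebesgue_rV] down to
    dimension 0. *)
Definition vec1 (t : T) : 'rV[R]_1 := row_mx t%:M (0 : 'rV_0).

Definition vec2 (z : T * T) : 'rV[R]_2 := row_mx z.1%:M (row_mx z.2%:M (0 : 'rV_0)).

Lemma vec1E t i j : vec1 t i j = t.
Proof.
rewrite (ord1 i) (ord1 j).
transitivity ((t%:M : 'M[R]_1) 0 0); last by rewrite mxE mulr1n.
by rewrite -[RHS](row_mxEl _ (0 : 'M[R]_(1, 0))); congr (fun_of_matrix _ _ _); exact: val_inj.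
Qed.

Lemma vec2E0 z : vec2 z 0 0 = z.1.
Proof.
transitivity ((z.1%:M : 'M[R]_1) 0 0); last by rewrite mxE mulr1n.
by rewrite -[RHS](row_mxEl _ (vec1 z.2)); congr (fun_of_matrix _ _ _); exact: val_inj.
Qed.

Lemma vec2E1 z : vec2 z 0 1 = z.2.
Proof.
rewrite -[RHS](vec1E _ 0 0) -[RHS](row_mxEr (z.1%:M : 'M[R]_1)).
by congr (fun_of_matrix _ _ _); exact: val_inj.
Qed.

Lemma dot_vec2 a z : dot a (vec2 z) = a 0 0 * z.1 + a 0 1 * z.2.
Proof.
rewrite /dot big_ord_recl big_ord1 vec2E0 (_ : lift _ _ = 1) ?vec2E1 //.
exact: val_inj.
Qed.

Lemma lebesgue_rV1 (A : set 'rV[R]_1) : measurable (vec1 @^-1` A) ->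
  lebesgue_rV A = mu (vec1 @^-1` A).
Proof.
by move=> mA; rewrite -(setIT (vec1 @^-1` A)) -integral_indic.
Qed.

Lemma lebesgue_rV2 (A : set 'rV[R]_2) : measurable (vec2 @^-1` A) ->
  lebesgue_rV A = mu2 (vec2 @^-1` A).
Proof.
move=> mA; rewrite /product_measure1 [LHS]/=.
apply: eq_integral => t _.
have secE : xsection (vec2 @^-1` A) t = vec1 @^-1` [set y | A (row_mx t%:M y)].
  by apply/seteqP; split=> s; rewrite /xsection /= inE.
have mAt := measurable_xsection t mA; rewrite secE in mAt.
rewrite [RHS](_ : _ = mu (xsection (vec2 @^-1` A) t)) // secE.
by rewrite -(lebesgue_rV1 mAt).
Qed.

(* [lebesgue_rV] is studied through a measure on a space carrying the library's
   measurable structure: [R] when [n = 1] and [R * R] when [n = 2]. *)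
Definition lebesgue_model n d (X : measurableType d)
    (m : {measure set X -> \bar R}) (f : X -> 'rV[R]_n) : Prop :=
  [/\ forall i, measurable_fun [set: X] ((fun z => f z 0 i) : X -> T),
      forall A, measurable (f @^-1` A) -> lebesgue_rV A = m (f @^-1` A),
      forall a b, a != 0 -> m (f @^-1` [set y | dot a y = b]) = 0%E
    & forall A (b : 'rV[R]_n) (M : 'M[R]_n), \det M != 0 -> measurable (f @^-1` A) ->
        (`|\det M|%:E * m (f @^-1` [set y | A (b + y *m M)%R]) = m (f @^-1` A))%E].

Lemma lebesgue_model1 : lebesgue_model mu vec1.
Proof.
split=> [i|A|a b a0|A b M].
- have -> : (fun z => vec1 z 0 i) = id by apply/funext => z; rewrite ord1 vec1E.
  exact: measurable_id.
- exact: lebesgue_rV1.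
- have a00 : a 0 0 != 0.
    by apply: contraNneq a0 => a00; apply/eqP/rowP => i; rewrite ord1 a00 mxE.
  suff -> : vec1 @^-1` [set y | dot a y = b] = [set b / a 0 0].
    exact: lebesgue_measure_set1.
  apply/seteqP; split=> t /=; rewrite /dot big_ord1 vec1E.
    by move=> <-; rewrite mulrAC divff ?mul1r.
  by move->; field.
- rewrite [M]mx11_scalar det_scalar1 => M0 mA.
  apply: etrans (lebesgue_measure_affine (b 0 0) M0 mA).
  congr (_ * mu _)%E; apply/funext => t /=; congr A.
  apply/rowP => i; rewrite [RHS]vec1E ord1 mul_mx_scalar [LHS]mxE; congr (_ + _).
  by rewrite mxE vec1E.
Qed.

Lemma lebesgue_model2 : lebesgue_model mu2 vec2.
Proof.
have I2 (P : 'I_2 -> Prop) : P 0 -> P 1 -> forall i, P i.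
  move=> P0 P1 [[|[|//]] i2]; first by rewrite (_ : Ordinal _ = 0) //; exact: val_inj.
  by rewrite (_ : Ordinal _ = 1) //; exact: val_inj.
split=> [|A|a b a0|A b M].
- apply: I2.
    have -> : (fun z => vec2 z 0 0) = fst by apply/funext => z; rewrite vec2E0.
    exact: measurable_fst.
  have -> : (fun z => vec2 z 0 1) = snd by apply/funext => z; rewrite vec2E1.
  exact: measurable_snd.
- exact: lebesgue_rV2.
(* A line parallel to the second axis is a null set times the whole axis; any other line meets each
   slice over the first coordinate in a single point. *)
- have [a1|a1] := eqVneq (a 0 1) 0.
    have a00 : a 0 0 != 0.
      by apply: contraNneq a0 => a00; apply/eqP/rowP; apply: I2; rewrite mxE.
    suff -> : vec2 @^-1` [set y | dot a y = b] = [set b / a 0 0] `*` setT.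
      apply: etrans (product_measure1E _ _ _ _) _ => //.
      apply: etrans (mul0e _); congr (_ * _)%E; exact: lebesgue_measure_set1.
    apply/seteqP; split=> -[t s] /=; rewrite dot_vec2 a1 mul0r addr0 /=.
      by move=> <-; split => //; rewrite mulrAC divff ?mul1r.
    by move=> [-> _]; field.
  rewrite /product_measure1; apply: integral0_eq => t _.
  apply: etrans (lebesgue_measure_set1 ((b - a 0 0 * t) / a 0 1)); congr (mu _).
  apply/seteqP; split=> s; rewrite /xsection /= inE /= dot_vec2 /=.
    by move=> <-; field.
  by move=> ->; field.
- rewrite det_mx22 => M0 mA.
  apply: etrans (lebesgue2_affine (b 0 0) (b 0 1) M0 mA).
  congr (_ * mu2 _)%E; apply/funext => z /=; congr A.
  by apply/rowP; apply: I2; rewrite ?(vec2E0, vec2E1) /= mxE -addrA; congr (_ + _);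
    rewrite mxE big_ord_recl big_ord1 ?vec2E0 (_ : lift _ _ = 1) ?vec2E1 1?mulrC
      1?(mulrC z.2) //; exact: val_inj.
Qed.

End LebesgueRV.

(** * Polyhedral sets and their measure *)

Lemma dot_mulmx (R : realType) n p (a : 'rV[R]_n) (y : 'rV[R]_p) (M : 'M[R]_(p, n)) :
  dot a (y *m M) = dot (a *m M^T) y.
Proof.
have dotE q (u v : 'rV[R]_q) : dot u v = (u *m v^T) 0 0.
  by rewrite mxE; apply: eq_bigr => i _; rewrite mxE.
by rewrite !dotE trmx_mul mulmxA.
Qed.

Lemma polyhedral_affine (R : realType) n p (A : set 'rV[R]_n) (b : 'rV[R]_n)
    (M : 'M[R]_(p, n)) :
  polyhedral A -> polyhedral [set y : 'rV[R]_p | A (b + y *m M)].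
Proof.
move=> [m [k [a [c ->]]]].
exists m, k, (fun i l => a i l *m M^T), (fun i l => c i l - dot (a i l) b).
by apply/seteqP; split=> y [i ayc]; exists i => l; have := ayc l;
  rewrite /= dotDr lerBrDl dot_mulmx.
Qed.

Section LebesgueModel.
Variables (R : realType) (n : nat) (d : measure_display) (X : measurableType d).
Variables (m : {measure set X -> \bar R}) (f : X -> 'rV[R]_n).
Hypothesis fm : lebesgue_model m f.

Lemma measurable_polyhedral (A : set 'rV[R]_n) : polyhedral A -> measurable (f @^-1` A).
Proof.
case: fm => mf _ _ _ [p [k [a [c ->]]]].
rewrite (_ : _ @^-1` _ = \bigcup_(i in [set: 'I_p]) \bigcap_(l in [set: 'I_k])
  [set z | dot (a i l) (f z) <= c i l]); last first.
  apply/seteqP; split=> z; first by case=> i iz; exists i => // l _; exact: iz.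
  by case=> i _ iz; exists i => l; exact: iz.
apply: fin_bigcup_measurable => // i _; apply: fin_bigcap_measurable => // l _.
rewrite (_ : [set z | _] = (fun z => dot (a i l) (f z) <= c i l) @^-1` [set true]) //.
apply: measurable_preimageT => //.
apply: measurable_fun_ler => //.
apply: measurable_sum => e; apply: measurable_funM => //.
exact: mf.
Qed.

Lemma measurable_hyperplane (a : 'rV[R]_n) (b : R) :
  measurable (f @^-1` [set y | dot a y = b]).
Proof.
apply: measurable_polyhedral.
exists 1%N, 2%N, (fun _ l => if l == 0 then a else - a),
  (fun _ l => if l == 0 then b else - b).
apply/seteqP; split=> y /=.
  by move=> <-; exists 0 => l; case: ifP => // _; rewrite dotNl.
move=> [i iy]; have /= := iy 1; have /= := iy 0; rewrite dotNl lerN2 => ab ba.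
by apply/eqP; rewrite eq_le ab ba.
Qed.

(** The identity between indicators holds off the union [N] of finitely many hyperplanes, which is a
    null set, so it can be integrated. *)
Lemma lebesgue_model_sum0 J (A : 'I_J -> set 'rV[R]_n) (c l : 'I_J -> R)
    (s : seq ('rV[R]_n * R)) :
  (forall p, p \in s -> p.1 != 0) -> (forall j, polyhedral (A j)) ->
  (forall j, lebesgue_rV (A j) = (l j)%:E) ->
  (forall y, (forall p, p \in s -> dot p.1 y != p.2) ->
    \sum_j c j * \1_(A j) y = 0) ->
  \sum_j c j * l j = 0.
Proof.
move=> s0 pA lA cA.
case: (fm) => _ lE h0 _.
have mA j : measurable (f @^-1` A j) by exact: measurable_polyhedral.
pose N := \bigcup_(p in [set` s]) f @^-1` [set y | dot p.1 y = p.2].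
have mN : measurable N.
  by apply: fin_bigcup_measurable => // p _; exact: measurable_hyperplane.
have N0 : m N = 0%E.
  apply/eqP; rewrite eq_le measure_ge0 andbT.
  have mH p : [set` s] p -> measurable (f @^-1` [set y | dot p.1 y = p.2]).
    by move=> _; exact: measurable_hyperplane.
  apply: le_trans (content_sub_fsum _ (finite_seq s) mH mN (@subset_refl _ _)) _.
  by rewrite fsbig1 // => p ps; apply: h0; exact: s0.
have iA j : m.-integrable setT (fun z => (\1_(f @^-1` A j) z)%:E).
  apply/integrableP; split; first by apply/measurable_EFinP; exact: measurable_indic.
  under eq_integral => z _ do rewrite gee0_abs ?lee_fin //.
  by rewrite integral_indic // setIT -lE // lA ltry.
apply/EFin_inj.
transitivity (\int[m]_z (\sum_j ((c j)%:E * (\1_(f @^-1` A j) z)%:E)))%E.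
  rewrite integral_sum //; last by move=> j; exact: integrableZl.
  rewrite -sumEFin; apply: eq_bigr => j _.
  by rewrite integralZl // integral_indic // setIT -lE // lA.
rewrite (@negligible_integral _ _ _ _ _ N) //; last first.
  by apply: integrable_sum => // j _; exact: integrableZl.
apply: integral0_eq => z [_ Nz].
under eq_bigr => j _ do rewrite -EFinM.
rewrite sumEFin cA // => p ps; apply/eqP => pz; apply: Nz; exists p => //.
Qed.

End LebesgueModel.

(** * Neighbourhoods, local constancy and crossings along a line *)

Lemma near_realP (R : realType) (t : R) (Q : R -> Prop) :
  (\forall u \near t, Q u) <->
  exists2 e, 0 < e & forall u, `|u - t| < e -> Q u.
Proof.
rewrite -[X in X <-> _]/(nbhs t Q); split.
  by move=> /nbhs_ballP[e /= e0 eQ]; exists e => // u tu; apply: eQ; rewrite -ball_normE /= distrC.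
by case=> e e0 eQ; apply/nbhs_ballP; exists e => //= u; rewrite -ball_normE /= distrC; exact: eQ.
Qed.

Lemma near_rVP (R : realType) n (x : 'rV[R]_n) (Q : 'rV[R]_n -> Prop) :
  (\forall y \near x, Q y) <->
  exists2 e, 0 < e & forall y : 'rV[R]_n, (forall i, `|y 0 i - x 0 i| < e) -> Q y.
Proof.
rewrite -[X in X <-> _]/(nbhs x Q); split.
  move=> /nbhs_ballP[e /= e0 eQ]; exists e => // y xy; apply: eQ.
  by split=> // i j; rewrite (ord1 i) -ball_normE /= distrC.
case=> e e0 eQ; apply/nbhs_ballP; exists e => //= y [_ xy]; apply: eQ => i.
by have := xy 0 i; rewrite -ball_normE /= distrC.
Qed.

Lemma near_line (R : realType) n (u w : 'rV[R]_n) (t : R) (Q : 'rV[R]_n -> Prop) :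
  (\forall y \near (u + t *: w), Q y) -> \forall s \near t, Q (u + s *: w).
Proof.
move=> /near_rVP[e e0 eQ]; apply/near_realP.
(* A Lipschitz constant of the line for the sup norm; [+ 1] keeps it positive when [w = 0]. *)
have C0 : 0 < \sum_i `|w 0 i| + 1 by rewrite ltr_wpDl // sumr_ge0.
exists (e / (\sum_i `|w 0 i| + 1)); first by rewrite divr_gt0.
move=> s; rewrite ltr_pdivlMr // => st; apply: eQ => i.
rewrite !mxE (_ : _ - _ = (s - t) * w 0 i) ?normrM; last by ring.
rewrite (le_lt_trans _ st) // ler_wpM2l //.
by rewrite (bigD1 i) //= -addrA lerDl addr_ge0 // sumr_ge0.
Qed.

Lemma near_dot_lt (R : realType) n (a x : 'rV[R]_n) (b : R) :
  dot a x < b -> \forall y \near x, dot a y < b.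
Proof.
move=> axb; apply/near_rVP.
have C0 : 0 < \sum_i `|a 0 i| + 1 by rewrite ltr_wpDl // sumr_ge0.
have e0 : 0 < (b - dot a x) / (\sum_i `|a 0 i| + 1) by rewrite divr_gt0 // subr_gt0.
exists ((b - dot a x) / (\sum_i `|a 0 i| + 1)) => // y xy.
rewrite -[y](subrK x) dotDr -ltrBrDr.
have -> : b - dot a x = (b - dot a x) / (\sum_i `|a 0 i| + 1) * (\sum_i `|a 0 i| + 1).
  by rewrite divfK // gt_eqF.
move: e0 xy; set e := _ / _ => e0 xy.
rewrite mulrDr mulr1 mulr_sumr; apply: le_lt_trans (_ : \sum_i e * `|a 0 i| < _).
  apply: ler_sum => i _; rewrite !mxE mulrC.
  apply: le_trans (ler_norm _) _; rewrite normrM ler_wpM2r //.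
  exact: ltW.
by rewrite ltrDl.
Qed.

(** Connectedness of the line, obtained from the derivative, which is zero everywhere. *)
Lemma locally_constant (R : realType) (g : R -> R) :
  (forall t, \forall u \near t, g u = g t) -> forall t u, g t = g u.
Proof.
move=> gloc t u; apply: is_derive_0_is_cst => x.
have := is_derive_cst (g x) x (1 : R).
apply: near_eq_is_derive.
by apply: filterS (gloc x) => y ->.
Qed.

(** Truncation to the unit interval, used to extend a function on a segment to the whole line. *)
Lemma clamp_exists (R : realType) : exists cl : R -> R,
  [/\ forall s, 0 <= cl s <= 1, forall s t, `|cl s - cl t| <= `|s - t|,
      cl 0 = 0 & cl 1 = 1].
Proof.
exists (fun s => Num.max 0 (Num.min 1 s)); split=> [s|s t||].
- by rewrite le_max lexx /= ge_max ler01 /= ge_min lexx.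
- have h1 := ler_norm (s - t); have h2 := ler_norm (- (s - t)); rewrite normrN in h2.
  rewrite ler_norml; case: (leP 1 s) => h3; case: (leP 1 t) => h4;
    case: (leP 0 s) => h5; case: (leP 0 t) => h6; case: (leP 0 (1 : R)) => h7; lra.
- by rewrite min_r ?ler01 // maxxx.
- by rewrite minxx max_r ?ler01.
Qed.

(** After clamping the parameter, the indicator of [I] along the segment is locally constant on the
    whole line, hence equal at 0 and 1. *)
Lemma segment_constant (R : realType) n (I : set 'rV[R]_n) (u w : 'rV[R]_n) :
  (forall s, 0 <= s <= 1 -> \forall y \near (u + s *: w), I y <-> I (u + s *: w)) ->
  I u <-> I (u + w).
Proof.
move=> nb; have [cl [cl01 clB cl0 cl1]] := clamp_exists R.
pose g s : R := if `[< I (u + cl s *: w) >] then 1 else 0.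
have gc : g 0 = g 1.
  apply: locally_constant => t.
  have /near_line/near_realP[e e0 eQ] := nb _ (cl01 t).
  apply/near_realP; exists e; first exact: e0.
  move=> s st; have /asbool_equiv_eq H := eQ (cl s) (le_lt_trans (clB _ _) st).
  by rewrite /g H.
move: gc; rewrite /g cl0 cl1 scale0r addr0 scale1r.
have := oner_neq0 R; case: asboolP => iu; case: asboolP => iw // /eqP h01 e01 //.
by case: h01; rewrite e01.
Qed.

Section Boundary.
Variables (R : realType) (n : nat) (P : set 'rV[R]_n).

(** Such a point lies in one of two open sets, the interior and the complement of the closure. *)
Lemma near_off_boundary (x : 'rV[R]_n) : ~ boundary P x ->
  \forall y \near x, P° y <-> P° x.
Proof.
move=> nbx; have [ix|nix] := pselect (P° x).
  by have := open_interior P; rewrite openE => /(_ _ ix); apply: filterS => y iy.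
have ncx : ~ closure P x by move=> cx; apply: nbx.
have : open (~` closure P) by apply: closed_openC; exact: closed_closure.
rewrite openE => /(_ _ ncx); apply: filterS => y ncy; split=> // iy.
by exfalso; apply: ncy; apply: subset_closure; exact: interior_subset.
Qed.

Lemma interior_segment (u w : 'rV[R]_n) :
  (forall s, 0 <= s <= 1 -> ~ boundary P (u + s *: w)) ->
  P° u <-> P° (u + w).
Proof.
by move=> nb; apply: segment_constant => s s01; apply: near_off_boundary; exact: nb.
Qed.

End Boundary.

(* [f], corrected by the jumps already passed, is locally constant; the value
   [b i] at [tau i] itself is the limit of [f] from the left. *)
Lemma crossing_sum (R : realType) (I : finType) (X : pred I) (tau : I -> R)
    (b : I -> bool) (f : R -> bool) (M : R) :
  (forall i j, X i -> X j -> tau i = tau j -> i = j) ->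
  (forall i, X i -> f (tau i) = false) ->
  (forall t, (forall i, X i -> tau i != t) -> \forall u \near t, f u = f t) ->
  (forall i, X i -> exists2 e, 0 < e & forall s, 0 < s < e ->
    f (tau i - s) = b i /\ f (tau i + s) = ~~ b i) ->
  (forall t, M < `|t| -> f t = false) ->
  \sum_(i | X i) ((-1) ^+ (~~ b i) : R) = 0.
Proof.
move=> tau_inj f_tau f_loc f_cross f_out.
pose jump i u : R := if tau i < u then (-1) ^+ (~~ b i)
  else if tau i == u then (b i)%:R else 0.
pose g u : R := (f u)%:R + \sum_(i | X i) jump i u.
have jump_loc i t : tau i != t ->
    \forall u \near t, tau i != u /\ jump i u = jump i t.
  move=> it; apply/near_realP; exists `|t - tau i|.
    by rewrite normr_gt0 subr_eq0 eq_sym.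
  move=> u; rewrite /jump; move: it; rewrite neq_lt => /orP[it|it].
    rewrite it (@gtr0_norm _ (t - tau i)) ?subr_gt0 // ltr_norml => /andP[h _].
    have iu : tau i < u by lra.
    by rewrite iu (lt_eqF iu).
  rewrite (@ltr0_norm _ (t - tau i)) ?subr_lt0 // ltr_norml => /andP[_ h].
  have ui : u < tau i by lra.
  by rewrite (gt_eqF ui) (gt_eqF it) !ltNge (ltW ui) (ltW it).
have g_loc t : \forall u \near t, g u = g t.
  have [[j Xj jt]|nt] := pselect (exists2 j, X j & tau j = t); last first.
    have nt' i : X i -> tau i != t by move=> Xi; apply/eqP => it; apply: nt; exists i.
    have : \forall u \near t, forall i : I, X i -> jump i u = jump i t.
      apply: (@filter_forall _ _ (fun i u => X i -> jump i u = jump i t) (nbhs t)) => i.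
      have [Xi|nXi] := boolP (X i); last by apply: nearW.
      by apply: filterS (jump_loc i t (nt' i Xi)) => u [_ ->].
    apply: filterS2 (f_loc t nt') => u fu ju.
    by rewrite /g fu; congr (_ + _); apply: eq_bigr => i Xi; exact: ju.
  have : \forall u \near t, forall i : I, X i -> i != j -> jump i u = jump i t.
    apply: (@filter_forall _ _ (fun i u => X i -> i != j -> jump i u = jump i t) (nbhs t)) => i.
    have [Xi|nXi] := boolP (X i); last by apply: nearW.
    have [->|ij] := eqVneq i j; first by apply: nearW.
    have it : tau i != t.
      by apply: contraNneq ij => it; rewrite (tau_inj i j) // it jt.
    by apply: filterS (jump_loc i t it) => u [_ ->].
  have [e e0 je] := f_cross j Xj.
  have : \forall u \near t, `|u - t| < e by apply/near_realP; exists e.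
  apply: filterS2 => u ut ju.
  (* Near [tau j] the sum of [f] and the [j]-th jump is constantly [b j]: on the left the jump is 0,
     at [tau j] it is [f] that is 0, and on the right the sign [(-1) ^+ (~~ b j)] turns [~~ b j]
     into [b j]. *)
  rewrite /g (bigD1 j) //= [in RHS](bigD1 j) //= !addrA; congr (_ + _).
    rewrite -jt f_tau // /jump ltxx eqxx.
    have [uj|uj|uj] := ltgtP u (tau j).
    - have [|+ _] := je (tau j - u).
        move: ut; rewrite -jt subr_gt0 uj /= ltr_norml => /andP[h _]; lra.
      rewrite subKr => ->.
      by rewrite ?(gt_eqF uj) addr0 add0r.
    - have [|_ +] := je (u - tau j).
        by move: ut; rewrite -jt subr_gt0 uj /= ltr_norml => /andP[_ h].
      rewrite (addrC (tau j)) subrK => ->; rewrite ?uj.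
      by case: (b j); rewrite /= ?expr0 ?expr1 ?addrN ?add0r.
    - by rewrite uj f_tau // ?ltxx ?eqxx.
  by apply: eq_bigr => i /andP[Xi ij]; exact: ju.
(* Beyond [K] in absolute value [f] is false and no crossing is left: [g (- K)] is 0, while [g K] is
   the full sum of signs. *)
pose K := `|M| + \sum_i `|tau i| + 1.
have tauK i : `|tau i| < K.
  rewrite /K (bigD1 i) //= ltr_pwDr // addrCA lerDl addr_ge0 // sumr_ge0 //.
have MK : M < K.
  by rewrite /K -addrA (le_lt_trans (ler_norm M)) // ltrDl ltr_wpDl // sumr_ge0.
have K0 : 0 < K by rewrite /K ltr_wpDl // addr_ge0 // sumr_ge0.
have := locally_constant g_loc K (- K).
rewrite /g !f_out ?normrN ?(gtr0_norm K0) // !add0r.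
under eq_bigr => i _.
  rewrite /jump (_ : tau i < K); last by have := tauK i; rewrite ltr_norml => /andP[].
  over.
move=> ->; apply: big1 => i _; rewrite /jump.
have iK : - K < tau i by have := tauK i; rewrite ltr_norml => /andP[].
by rewrite ltNge (ltW iK) /= (gt_eqF iK).
Qed.

(** * Graphs over a coordinate hyperplane and projections of facets *)

Section Insertion.
Variables (R : realType) (n : nat) (k : 'I_n.+1).

Definition insert0 : 'M[R]_(n, n.+1) := row' k 1%:M.

Lemma mul_insert0k (z : 'rV[R]_n) : (z *m insert0) 0 k = 0.
Proof.
rewrite mxE big1 // => i _.
by rewrite !mxE eq_sym (negbTE (neq_lift _ _)) mulr0.
Qed.

Lemma mul_insert0_lift (z : 'rV[R]_n) i : (z *m insert0) 0 (lift k i) = z 0 i.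
Proof.
rewrite mxE (bigD1 i) //= !mxE eqxx mulr1 big1 ?addr0 // => j ji.
by rewrite !mxE (inj_eq lift_inj) (negbTE ji) mulr0.
Qed.

Lemma row_insert (x : 'rV[R]_n.+1) :
  x = col' k x *m insert0 + x 0 k *: delta_mx 0 k.
Proof.
apply/rowP => i; rewrite [RHS]mxE; case: (unliftP k i) => [j|] ->.
  rewrite mul_insert0_lift !mxE eqxx [lift k j == k]eq_sym.
  by rewrite (negbTE (neq_lift _ _)) mulr0 addr0.
by rewrite mul_insert0k !mxE !eqxx mulr1 add0r.
Qed.

Lemma dot_insert (x : 'rV[R]_n.+1) (z : 'rV[R]_n) :
  dot x (z *m insert0) = dot (col' k x) z.
Proof.
rewrite /dot (bigD1_ord k) //= mul_insert0k mulr0 add0r.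
by apply: eq_bigr => i _; rewrite mul_insert0_lift mxE.
Qed.

(* The hyperplane [dot x y = c] as a graph over the coordinates other than [k];
   meaningless if [x 0 k = 0]. *)
Definition graph_height (x : 'rV[R]_n.+1) (c : R) (z : 'rV[R]_n) : R :=
  (c - dot (col' k x) z) / x 0 k.

Definition graph_point (x : 'rV[R]_n.+1) (c : R) (z : 'rV[R]_n) : 'rV[R]_n.+1 :=
  z *m insert0 + graph_height x c z *: delta_mx 0 k.

(** The explicit affine form, needed to see that preimages of polyhedral sets are polyhedral. *)
Lemma graph_pointE (x : 'rV[R]_n.+1) c z : graph_point x c z =
  (c / x 0 k) *: delta_mx 0 k +
  z *m (insert0 - (x 0 k)^-1 *: ((col' k x)^T *m delta_mx 0 k)).
Proof.
have -> : z *m (insert0 - (x 0 k)^-1 *: ((col' k x)^T *m delta_mx 0 k)) =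
    z *m insert0 - (dot (col' k x) z / x 0 k) *: delta_mx 0 k.
  rewrite mulmxBr -scalemxAr mulmxA; congr (_ - _).
  rewrite (mx11_scalar (z *m _)) mul_scalar_mx scalerA mulrC; congr (_ / _ *: _).
  by rewrite mxE dotC; apply: eq_bigr => i _; rewrite [in LHS]mxE.
by rewrite /graph_point /graph_height mulrBl scalerBl addrC addrAC addrA.
Qed.

Lemma graph_point_dot (x : 'rV[R]_n.+1) c z : x 0 k != 0 -> dot x (graph_point x c z) = c.
Proof.
move=> xk; rewrite /graph_point dotDr dot_insert dotZr (dotC x) dot_delta.
by rewrite /graph_height divfK // addrC subrK.
Qed.

Lemma graph_point_col' (x : 'rV[R]_n.+1) c y : x 0 k != 0 -> dot x y = c ->
  graph_point x c (col' k y) = y.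
Proof.
move=> xk <-; rewrite [RHS](row_insert y) /graph_point; congr (_ + _ *: _).
rewrite /graph_height [in dot x y](row_insert y) dotDr dot_insert dotZr (dotC x) dot_delta.
by rewrite addrAC subrr add0r mulfK.
Qed.

(* Cofactor expansion of the orthogonal matrix with first row [x] and other rows
   [E], whose inverse is its transpose. *)
Lemma norm_det_col' (x : 'rV[R]_n.+1) (E : 'M[R]_(n, n.+1)) :
  dot x x = 1 -> E *m E^T = 1%:M -> E *m x^T = 0 ->
  `|\det (col' k E)| = `|x 0 k|.
Proof.
move=> x1 EE Ex.
have xEE : col_mx x E *m (col_mx x E)^T = 1%:M.
  rewrite tr_col_mx mul_col_row EE Ex -[x *m E^T]trmxK trmx_mul trmxK Ex trmx0.
  rewrite (_ : x *m x^T = 1%:M) -?scalar_mx_block //.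
  rewrite [LHS]mx11_scalar; congr _%:M; rewrite mxE -[RHS]x1.
  by apply: eq_bigr => i _; rewrite mxE.
have [ M [MM Mx ME]] : exists M : 'M[R]_n.+1,
    [/\ M *m M^T = 1%:M, forall j, M 0 j = x 0 j & row' 0 M = E].
  exists (col_mx x E : 'M[R]_(1 + n, n.+1)); split=> // [j|].
    by rewrite -(col_mxEu x E); congr (fun_of_matrix _ _ _); exact: val_inj.
  apply/matrixP => i j; rewrite mxE -(col_mxEd x E); congr (fun_of_matrix _ _ _).
  exact: val_inj.
have detM : `|\det M| = 1.
  have /(congr1 determinant) := MM; rewrite det_mulmx det_tr det1 => /(congr1 Num.norm).
  rewrite normrM normr1 -expr2 => /eqP; rewrite sqrf_eq1 => /orP[/eqP //|/eqP h].
  by have := normr_ge0 (\det M); rewrite h oppr_ge0 ler10.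
(* The inverse of [M] is its transpose, so each cofactor is, up to sign, an entry of [M]; the one
   for row 0 and column [k] is the determinant sought. *)
have adjE : \adj M = \det M *: M^T.
  by rewrite -[LHS]mul1mx -(mulmx1C MM) -mulmxA mul_mx_adj mul_mx_scalar.
have /matrixP/(_ k 0) := adjE; rewrite !mxE Mx => /(congr1 Num.norm).
rewrite (normrM (\det M)) detM mul1r /cofactor normrM normrX normrN1 expr1n mul1r => <-.
by rewrite -ME; congr `|\det _|; apply/matrixP => i j; rewrite !mxE.
Qed.

(** The isometric chart followed by the projection along the [k]-th axis is affine with matrix
    [col' k E], whose determinant is [x 0 k] up to sign. The change of variables therefore scales
    the measure by that factor. *)
Lemma facet_projection (F : set 'rV[R]_n.+1) (x : 'rV[R]_n.+1) (l : R) d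
    (X : measurableType d) (m : {measure set X -> \bar R}) (f : X -> 'rV[R]_n) :
  lebesgue_model m f -> polyhedral F -> dot x x = 1 -> hyperplane_measure x F l ->
  exists2 c, F `<=` [set y | dot x y = c]
    & x 0 k != 0 ->
      lebesgue_rV [set z | F (graph_point x c z)] = (`|x 0 k| * l)%:E.
Proof.
move=> fm Fpoly x1 [a [E [EE Ex FE FL]]].
have xE y : dot x (a + y *m E) = dot x a.
  by rewrite dotDr dot_mulmx -[x *m E^T]trmxK trmx_mul trmxK Ex trmx0 dot0l addr0.
exists (dot x a) => [y /FE [z _ <-]|xk] /=; first exact: xE.
set A := [set z | _].
have Apoly : polyhedral A.
  rewrite /A; under eq_fun => z do rewrite graph_pointE.
  exact: polyhedral_affine.
have AE : [set y | F (a + y *m E)] = [set y | A (col' k a + y *m col' k E)].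
  apply/funext => y /=; rewrite /A /= -[X in F X](graph_point_col' xk (xE y)).
  congr (F (graph_point _ _ _)); rewrite linearD /=; congr (_ + _).
  by apply/matrixP => i j; rewrite !mxE; apply: eq_bigr => q _; rewrite mxE.
have detE := norm_det_col' x1 EE Ex.
have [_ lE _ aff] := fm.
have mA : measurable (f @^-1` A) by exact: (measurable_polyhedral fm).
rewrite lE // -(aff _ (col' k a) (col' k E)) //; last by rewrite -normr_gt0 detE normr_gt0.
have mA' : measurable (f @^-1` [set y | A (col' k a + y *m col' k E)]).
  by apply: (measurable_polyhedral fm); exact: polyhedral_affine.
by rewrite -lE // -AE /= FL detE EFinM.
Qed.

End Insertion.

(** * Crossing the boundary through a facet *)

Section FacetCrossing.
Variables (R : realType) (d J : nat) (P : set 'rV[R]_d).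
Variables (F : 'I_J -> set 'rV[R]_d) (xi : 'I_J -> 'rV[R]_d) (L : 'I_J -> R).
Hypothesis P_facets : facets P F xi L.

Lemma facet_closed j : closed (F j).
Proof. by rewrite -(facets_regular P_facets j); exact: closed_closure. Qed.

(** The other facets are closed and avoid [x], so near [x] the boundary lies in [F j] and hence in
    its hyperplane. *)
Lemma facet_locally_flat j x : relint (xi j) (F j) x ->
  \forall y \near x, boundary P y -> dot (xi j) (y - x) = 0.
Proof.
move=> Fx; have [_ [c Fc] _] := facets_normal P_facets j.
have : \forall y \near x, forall i, i != j -> ~ F i y.
  apply: (@filter_forall _ _ (fun i y => i != j -> ~ F i y) (nbhs x)) => i.
  have [->|ij] := eqVneq i j; first by apply: nearW.
  have nFx : ~ F i x.
    move=> Fix; have : (relint (xi j) (F j) `&` F i) x by [].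
    by rewrite (facets_simple P_facets) // eq_sym.
  have : open (~` F i) by apply: closed_openC; exact: facet_closed.
  by rewrite openE => /(_ x nFx); apply: filterS.
apply: filterS => y nF by_; have [i _ Fiy] : (\bigcup_(j in [set: 'I_J]) F j) y.
  by rewrite -(facets_boundary P_facets).
have [ij|ij] := eqVneq i j; last by case: (nF i ij Fiy).
rewrite dotDr dotNr; have -> : dot (xi j) y = c by apply: Fc; rewrite -ij.
have -> : dot (xi j) x = c by apply: Fc; case: Fx.
by rewrite subrr.
Qed.

(* Near a relative interior point of a facet the two sides of its hyperplane do
   not meet the boundary, so that the normal can be replaced by any transverse
   direction [e]. *)
Lemma facet_crossing j x e : relint (xi j) (F j) x -> 0 < dot (xi j) e ->
  exists2 r, 0 < r & forall s, 0 < s < r -> P° (x - s *: e) /\ ~ P° (x + s *: e).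
Proof.
move=> Fx xe; have [xi1 _ /(_ _ Fx) out] := facets_normal P_facets j.
have {}xi1 : dot (xi j) (xi j) = 1 by rewrite -enorm_sqr xi1 expr1n.
have /near_rVP[r r0 flat] := facet_locally_flat Fx.
have /near_realP[t0 t00 {}out] : \forall t \near (0 : R),
  0 < t -> P° (x - t *: xi j) /\ ~ P (x + t *: xi j) by exact: out.
have le_sum (u : 'rV[R]_d) i : `|u 0 i| <= \sum_k `|u 0 k|.
  by rewrite (bigD1 i) //= lerDl sumr_ge0.
have sum_ge0 (u : 'rV[R]_d) : 0 <= \sum_k `|u 0 k| by rewrite sumr_ge0.
(* [C] bounds all coordinates of [xi j] and [e], so steps shorter than [r / C] stay in the
   neighbourhood where the boundary is flat. *)
pose C := 1 + \sum_i `|xi j 0 i| + \sum_i `|e 0 i|.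
have xC i : `|xi j 0 i| <= C.
  by have := le_sum (xi j) i; have := sum_ge0 e; rewrite /C; lra.
have eC i : `|e 0 i| <= C.
  by have := le_sum e i; have := sum_ge0 (xi j); rewrite /C; lra.
have C0 : 0 < C.
  by have := sum_ge0 e; have := sum_ge0 (xi j); rewrite /C; lra.
(* The segment joining the two points stays strictly on the side [sg] of the hyperplane, so it
   misses the boundary and its ends are both interior or both not. *)
have side sg t s : `|sg| = 1 -> 0 < t < r / C -> 0 < s < r / C ->
    P° (x + (sg * t) *: xi j) <-> P° (x + (sg * s) *: e).
  move=> sg1 /andP[t_gt0 tr] /andP[s_gt0 sr].
  rewrite -[_ + (sg * s) *: e](addrNK (x + (sg * t) *: xi j)).
  rewrite [_ + (x + _ *: xi j)]addrC.
  apply: interior_segment => q /andP[q0 q1] bq.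
  set w := (X in boundary P X) in bq.
  have wx : w - x = sg *: (((1 - q) * t) *: xi j + (q * s) *: e).
    rewrite /w; apply/rowP => i; rewrite !mxE; ring.
  have : dot (xi j) (w - x) = 0.
    apply: flat bq => i.
    have -> : w 0 i - x 0 i = (w - x) 0 i by rewrite !mxE.
    rewrite wx !mxE normrM sg1 mul1r.
    apply: le_lt_trans (ler_normD _ _) _; rewrite !normrM.
    rewrite ltr_pdivlMr // in tr; rewrite ltr_pdivlMr // in sr.
    rewrite (ger0_norm q0) (gtr0_norm s_gt0) (gtr0_norm t_gt0) ger0_norm ?subr_ge0 //.
    have h1 := xC i; have h2 := eC i.
    have h3 : t * `|xi j 0 i| < r by apply: le_lt_trans tr; rewrite ler_pM2l.
    have h4 : s * `|e 0 i| < r by apply: le_lt_trans sr; rewrite ler_pM2l.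
    move: h3 h4; rewrite -!mulrA; move: (t * _) (s * _) => A B A_r B_r.
    have m_r : Num.max A B < r by rewrite gt_max A_r B_r.
    apply: le_lt_trans m_r.
    have A_m : A <= Num.max A B by rewrite le_max lexx.
    have B_m : B <= Num.max A B by rewrite le_max lexx orbT.
    have q1' : 0 <= 1 - q by rewrite subr_ge0.
    have := ler_wpM2l q1' A_m; have := ler_wpM2l q0 B_m; lra.
  rewrite wx dotZr dotDr !dotZr xi1 mulr1 => /eqP; rewrite mulf_eq0 -normr_eq0 sg1 oner_eq0 /=.
  rewrite gt_eqF //.
  move: q0; rewrite le_eqVlt => /predU1P[<-|q0].
    by rewrite subr0 mul1r !mul0r addr0.
  rewrite ltr_wpDl ?mulr_gt0 // mulr_ge0 ?subr_ge0 //; exact: ltW.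
exists (r / C) => [|s sr]; first by rewrite divr_gt0.
(* A step along the normal, short enough for both [out] and [side]. *)
pose t := Num.min t0 (r / C) / 2.
have m0 : 0 < Num.min t0 (r / C) by rewrite lt_min t00 divr_gt0.
have tm : t < Num.min t0 (r / C) by rewrite /t; lra.
have t_gt0 : 0 < t by rewrite divr_gt0.
have [|//|outP outN] := out t; first by rewrite subr0 gtr0_norm // (lt_le_trans tm) // ge_min lexx.
have tr : 0 < t < r / C by rewrite t_gt0 (lt_le_trans tm) // ge_min lexx orbT.
have := side (-1) t s; rewrite normrN1 !mulN1r !scaleNr => /(_ erefl tr sr) H1.
have := side 1 t s; rewrite normr1 !mul1r => /(_ erefl tr sr) H2.
case: H1 H2 => [H1 _] [_ H2]; split; first exact: H1.
by move=> h; apply: outN; apply: interior_subset; exact: H2.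
Qed.

End FacetCrossing.

(** * The closing condition *)

(** Off the hyperplanes of the constraints with nonzero normal, a point of [A] satisfies every such
    constraint strictly, and this persists nearby; constraints with zero normal do not depend on the
    point. *)
Lemma polyhedral_off_hyperplanes (R : realType) n (A : set 'rV[R]_n) :
  polyhedral A -> exists s : seq ('rV[R]_n * R),
    (forall p, p \in s -> p.1 != 0) /\
    forall y, (forall p, p \in s -> dot p.1 y != p.2) -> A y -> \forall z \near y, A z.
Proof.
move=> [p [q [a [b ->]]]].
exists [seq u <- [seq (a i l, b i l) | i <- enum 'I_p, l <- enum 'I_q] | u.1 != 0].
split=> [u|y good [i iy]]; first by rewrite mem_filter => /andP[].
have : \forall z \near y, forall l, dot (a i l) z <= b i l.
  apply: (@filter_forall _ _ (fun l z => dot (a i l) z <= b i l) (nbhs y)) => l.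
  have [al0|al0] := eqVneq (a i l) 0.
    by apply: nearW => z; have := iy l; rewrite al0 !dot0l.
  have : dot (a i l) y < b i l.
    rewrite lt_neqAle iy andbT; apply: (good (a i l, b i l)).
    by rewrite mem_filter al0; apply/allpairsP; exists (i, l); rewrite !mem_enum.
  by move/near_dot_lt; apply: filterS => z /ltW.
by apply: filterS => z iz; exists i.
Qed.

Section Closing.
Variables (R : realType) (n J : nat) (P : set 'rV[R]_n.+1).
Variables (F : 'I_J -> set 'rV[R]_n.+1) (xi : 'I_J -> 'rV[R]_n.+1) (L : 'I_J -> R).
Hypothesis P_polytope : polytope P.
Hypothesis P_facets : facets P F xi L.

Lemma polytope_coord_bounded k : exists M : R, forall x, P x -> `|x 0 k| <= M.
Proof.
have : compact ((fun x : 'rV[R]_n.+1 => x 0 k) @` P).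
  apply: continuous_compact; last exact: polytope_compact P_polytope.
  by apply: continuous_subspaceT => x; exact: coord_continuous.
move=> /compact_bounded [M [_ MP]].
exists (M + 1) => x Px; apply: (MP (M + 1)); first by rewrite ltrDl.
by exists x.
Qed.

Lemma boundary_not_interior x : boundary P x -> ~ P° x.
Proof. by case. Qed.

Lemma facet_boundary j x : F j x -> boundary P x.
Proof. by move=> Fx; rewrite (facets_boundary P_facets); exists j. Qed.

(** Without facets the boundary would be empty, and a segment from a point of [P] to beyond its
    coordinate bound would stay in the interior. *)
Lemma facets_nonempty : (0 < J)%N.
Proof.
rewrite lt0n; apply/eqP => J0.
have nb x : ~ boundary P x.
  by rewrite (facets_boundary P_facets) => -[j _ _]; case: j => j; rewrite J0.
have [x Px] := polytope_nonempty P_polytope.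
have ix : P° x.
  apply: contrapT => nix; apply: (nb x); split => //; exact: subset_closure.
have [M MP] := polytope_coord_bounded ord0.
pose e : 'rV[R]_n.+1 := (M + `|x 0 0| + 1) *: delta_mx 0 0.
have [/(_ ix) + _] := interior_segment (P := P) (u := x) (w := e) (fun s _ => nb _).
move=> /interior_subset /MP; rewrite !mxE !eqxx mulr1.
have := ler_norm (x 0 ord0 + (M + `|x 0 ord0| + 1)).
have := ler_norm (- x 0 ord0); rewrite normrN.
lra.
Qed.

Lemma facets_measure_sum_gt0 : 0 < \sum_j L j.
Proof.
rewrite (bigD1 (Ordinal facets_nonempty)) //= ltr_pwDl ?(facets_measure_gt0 P_facets) //.
by apply: sumr_ge0 => j _; apply: ltW; exact: (facets_measure_gt0 P_facets).
Qed.

Lemma facets_closing_coord d (X : measurableType d)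
    (m : {measure set X -> \bar R}) (f : X -> 'rV[R]_n) k :
  lebesgue_model m f -> \sum_j L j * xi j 0 k = 0.
Proof.
move=> fm.
have xi1 j : dot (xi j) (xi j) = 1.
  by have [x1 _ _] := facets_normal P_facets j; rewrite -enorm_sqr x1 expr1n.
have /choice[c cP] : forall j, exists c, F j `<=` [set y | dot (xi j) y = c] /\
    (xi j 0 k != 0 -> lebesgue_rV [set z | F j (graph_point k (xi j) c z)]
                      = (`|xi j 0 k| * L j)%:E).
  move=> j; have [c Fc FL] := facet_projection k fm (facets_polyhedral P_facets j)
    (xi1 j) (facets_measure P_facets j).
  by exists c.
pose gp j := graph_point k (xi j) (c j).
(* The projection of the facet along the axis; facets parallel to the axis are not graphs and get
   the empty set. *)
pose A j := if xi j 0 k == 0 then set0 else [set z | F j (gp j z)].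
have poly0 : polyhedral (set0 : set 'rV[R]_n).
  exists 0%N, 0%N, (fun _ _ => 0), (fun _ _ => 0).
  by apply/seteqP; split => // z [[]].
have Apoly j : polyhedral (A j).
  rewrite /A; case: ifPn => // xk.
  rewrite /gp; under eq_fun => z do rewrite graph_pointE.
  by apply: polyhedral_affine; exact: (facets_polyhedral P_facets).
have AL j : lebesgue_rV (A j) = (`|xi j 0 k| * L j)%:E.
  rewrite /A; case: ifPn => [/eqP xk|xk]; last by have [_ ->] := cP j.
  have [_ lE _ _] := fm.
  by rewrite lE preimage_set0 // measure0 xk normr0 mul0r.
(* Exceptional hyperplanes: for a facet parallel to the axis, the one containing its projection; for
   any other, those bounding its projection. Off them the line over [z] misses the former and meets
   the latter only at relative interior points. *)
have /choice[s sP] : forall j, exists s : seq ('rV[R]_n * R),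
    (forall p, p \in s -> p.1 != 0) /\
    forall z, (forall p, p \in s -> dot p.1 z != p.2) ->
      (xi j 0 k = 0 -> forall t, ~ F j (z *m insert0 R k + t *: delta_mx 0 k)) /\
      (A j z -> relint (xi j) (F j) (gp j z)).
  move=> j; have [Fc _] := cP j; have [xk|xk] := eqVneq (xi j 0 k) 0.
    exists [:: (col' k (xi j), c j)]; split=> [p|z good].
      rewrite inE => /eqP -> /=; apply/eqP => x0.
      have := xi1 j; rewrite [X in dot X _](row_insert k) x0 mul0mx add0r xk scale0r dot0l.
      by move/esym/eqP; rewrite oner_eq0.
    split=> [_ t /Fc /=|]; last by rewrite /A xk eqxx.
    rewrite dotDr dot_insert dotZr (dotC (xi j)) dot_delta xk mulr0 addr0 => /eqP.
    by apply/negP; apply: (good (_, _)); rewrite inE.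
  have [s [s0 sA]] := polyhedral_off_hyperplanes (Apoly j).
  exists s; split=> // z good; split=> [x0|Az]; first by rewrite x0 eqxx in xk.
  have Fz : F j (gp j z) by move: Az; rewrite /A (negbTE xk).
  split=> //; have /near_rVP[e e0 eA] := sA z good Az.
  apply/near_rVP; exists e => // y zy; rewrite dotDr dotNr => /eqP; rewrite subr_eq0.
  rewrite graph_point_dot // => /eqP yc.
  have : A j (col' k y).
    apply: eA => i; have := zy (lift k i).
    rewrite /gp /graph_point [X in _ - X]mxE mul_insert0_lift !mxE eqxx.
    by rewrite [_ == k]eq_sym (negbTE (neq_lift _ _)) mulr0 addr0.
  by rewrite /A (negbTE xk) /= /gp graph_point_col'.
(* The [k]-th coordinate of the closing sum is a signed sum of the measures of the projections. *)
have sumE : \sum_j Num.sg (xi j 0 k) * (`|xi j 0 k| * L j) = \sum_j L j * xi j 0 k.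
  by apply: eq_bigr => j _; rewrite mulrA -numEsg mulrC.
rewrite -sumE.
apply: (lebesgue_model_sum0 fm (s := flatten [seq s j | j <- enum 'I_J])) Apoly AL _.
  by move=> p /flatten_mapP[j _ ps]; have [s0 _] := sP j; exact: s0.
move=> z good.
have {}good j : (xi j 0 k = 0 -> forall t, ~ F j (z *m insert0 R k + t *: delta_mx 0 k)) /\
      (A j z -> relint (xi j) (F j) (gp j z)).
  have [_ ] := sP j; apply=> p ps; apply: good.
  by apply/flatten_mapP; exists j; rewrite ?mem_enum.
have Axk j : A j z -> xi j 0 k != 0 by rewrite /A; case: ifP.
have AF j : A j z -> F j (gp j z) by rewrite /A; case: ifP.
(* [ell] parametrizes the line over [z], which reaches the hyperplane of [F j] at [tau j]. *)
pose tau j := graph_height k (xi j) (c j) z.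
pose ell t := z *m insert0 R k + t *: delta_mx 0 k.
have ellD t u : ell (t + u) = ell t + u *: delta_mx 0 k by rewrite /ell scalerDl addrA.
have [M MP] := polytope_coord_bounded k.
(* With an outward normal of positive [k]-th coordinate the line leaves the interior at [tau j], so
   that coordinate decides the value of [b j]. *)
have := @crossing_sum R _ (fun j => `[< A j z >]) tau (fun j => 0 < xi j 0 k)
  (fun t => `[< P° (ell t) >]) M.
move=> /(_ _ _ _ _ _) cross.
rewrite (bigID (fun j => `[< A j z >])) /= [X in _ + X]big1 ?addr0; last first.
  by move=> j /asboolPn nA; rewrite indicE memNset // mulr0.
rewrite -[RHS]cross.
- apply: eq_bigr => j /asboolP Aj; rewrite indicE mem_set // mulr1.
  have := Axk j Aj; rewrite neq_lt => /orP[x0|x0].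
    by rewrite (ltr0_sg x0) ltNge (ltW x0).
  by rewrite (gtr0_sg x0) x0.
(* Two facets met at the same parameter would share a relative interior point of one of them. *)
- move=> i j /asboolP Ai /asboolP Aj tij.
  apply/eqP; apply: contrapT => /negP ij.
  have [_ /(_ Ai) ri] := good i.
  have : (relint (xi i) (F i) `&` F j) (gp i z).
    split => //; have := AF j Aj; rewrite /gp /graph_point -/(tau i) -/(tau j) tij.
    by [].
  by rewrite (facets_simple P_facets).
- move=> j /asboolP Aj; apply/asboolPn; apply: boundary_not_interior.
  by apply: facet_boundary; exact: AF.
- move=> t nt.
  have : ~ boundary P (ell t).
    rewrite (facets_boundary P_facets) => -[j _ Ft].
    have [xk|xk] := eqVneq (xi j 0 k) 0; first by have [/(_ xk t)] := good j.
    have [/(_ _ Ft) /= Fc _] := cP j.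
    have tE : tau j = t.
      rewrite /tau /graph_height -Fc /ell dotDr dot_insert dotZr (dotC (xi j)) dot_delta.
      by rewrite addrAC subrr add0r mulfK.
    have Aj : A j z.
      by rewrite /A (negbTE xk) /= /gp /graph_point -/(tau j) tE.
    by have /eqP := nt j (asboolT Aj).
  move=> /near_off_boundary/near_line; apply: filterS => u H.
  exact: asbool_equiv_eq.
- move=> j /asboolP Aj; have xk := Axk j Aj.
  have [_ /(_ Aj) rj] := good j.
  (* The axis is oriented by the sign of [xi j 0 k], so that it crosses the facet outwards. *)
  have : 0 < dot (xi j) (Num.sg (xi j 0 k) *: delta_mx 0 k).
    by rewrite dotZr dotC dot_delta -normrEsg normr_gt0.
  move=> /(facet_crossing P_facets rj)[r r0 rP]; exists r => // u ur.
  have [] := rP u ur; rewrite /gp /graph_point -/(tau j) -/(ell (tau j)).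
  move: xk; rewrite neq_lt => /orP[x0|x0].
    rewrite (ltr0_sg x0) scaleN1r scalerN opprK -!ellD -scaleNr -ellD => h1 h2.
    by rewrite ltNge (ltW x0) /=; split; [apply/asboolPn|apply/asboolP].
  rewrite (gtr0_sg x0) scale1r -scaleNr -!ellD => h1 h2.
  by rewrite x0 /=; split; [apply/asboolP|apply/asboolPn].
- move=> t Mt; apply/asboolPn => /interior_subset /MP.
  rewrite /ell mxE mul_insert0k !mxE !eqxx mulr1 add0r => tM.
  by move: Mt; rewrite ltNge tM.
Qed.

End Closing.

(** The projections lie in dimension 1 or 2, where [lebesgue_model1] and [lebesgue_model2] apply. *)
Lemma facets_closing (R : realType) (d J : nat) (P : set 'rV[R]_d)
    (F : 'I_J -> set 'rV[R]_d) (xi : 'I_J -> 'rV[R]_d) (L : 'I_J -> R) :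
  d = 2%N \/ d = 3%N -> polytope P -> facets P F xi L ->
  \sum_j L j *: xi j = 0 /\ 0 < \sum_j L j.
Proof.
move=> [d2|d3] P_polytope P_facets; subst d; split.
- apply/rowP => k; rewrite summxE mxE.
  rewrite -[RHS](facets_closing_coord P_polytope P_facets k (@lebesgue_model1 R)).
  by apply: eq_bigr => j _; rewrite mxE.
- exact: (facets_measure_sum_gt0 P_polytope P_facets).
- apply/rowP => k; rewrite summxE mxE.
  rewrite -[RHS](facets_closing_coord P_polytope P_facets k (@lebesgue_model2 R)).
  by apply: eq_bigr => j _; rewrite mxE.
- exact: (facets_measure_sum_gt0 P_polytope P_facets).
Qed.

Unset Implicit Arguments.

Theorem theorem2p4 (R : realType) (h : R -> R -> R)
    (h_eos : equation_of_state h)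
    (prim : state R -> primitive R) (prim_recovery : primitive_recovery h prim)
    (d : nat) (d23 : d = 2%N \/ d = 3%N)
    (J : nat) (P : set 'rV[R]_d) (F : 'I_J -> set 'rV[R]_d)
    (xi : 'I_J -> 'rV[R]_d) (L : 'I_J -> R)
    (P_polytope : polytope P) (P_facets : facets P F xi L)
    (Q : nat) (omega : 'I_Q -> R)
    (omega_gt0 : forall i, 0 < omega i) (omega_sum : \sum_(i < Q) omega i = 1)
    (U : 'I_Q -> 'I_J -> state R)
    (U_admissible : forall i j, admissible_states h (U i j))
    (U_div_free :
      \sum_(j < J)
        (\sum_(i < Q) omega i * dir_magnetic (xi j) (state_B (U i j))) * L j
      = 0)
    (alpha : R) (alpha_ge1 : 1 <= alpha) :
  closed_admissible_states
    ((\sum_(j < J) L j)^-1 *: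
      \sum_(j < J) L j *:
        \sum_(i < Q) omega i *:
          (U i j - alpha^-1 *: dir_flux h (xi j) (prim (U i j)))).

Proof.
have [closed sumL] := facets_closing d23 P_polytope P_facets.
have adm i j : admissible (prim (U i j)) by have [] := prim_recovery _ (U_admissible i j).
have UE i j : U i j = conservative h (prim (U i j))
  by have [] := prim_recovery _ (U_admissible i j).
(* Only the occurrences of [U i j] outside [prim] are to be expanded. *)
have -> : \sum_(j < J) L j *: (\sum_(i < Q) omega i *:
      (U i j - alpha^-1 *: dir_flux h (xi j) (prim (U i j)))) =
    \sum_(j < J) L j *: \sum_(i < Q) omega i *:
      (conservative h (prim (U i j)) - alpha^-1 *: dir_flux h (xi j) (prim (U i j))).
  by apply: eq_bigr => j _; congr (_ *: _); apply: eq_bigr => i _; rewrite -UE.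
apply: average_admissible => //.
- exact: eos_lower_bound h_eos.
- by case: d23 => ->.
- by move=> j; have [] := facets_normal P_facets j.
- exact: facets_measure_gt0 P_facets.
- rewrite -[RHS]U_div_free; apply: eq_bigr => j _; congr (_ * _).
  by apply: eq_bigr => i _; rewrite [in RHS]UE state_B_conservative.
Qed.
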